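(* Let $T\ge1$ be an integer, $\delta\in(0,1)$, $\eta>0$ and $G_0>0$ arbitrary. Let $f:\mathbb{R}^d\to\mathbb{R}$ be $L$-smooth and suppose that Assumptions 1, 2 and 3 hold (with constants $A,B,C>0$). Let $\{\overline{x}_t\}_{t\in[T]}$ be generated by AdaGrad-Norm or by RSAG with the adaptive step size $\eta_t=\eta/\left(G_0^2+\sum_{k=1}^t\|g_k\|^2\right)^{1/2}$. Put $\overline{\Delta}_1=f(x_1)-f^*$, $X=2A+4LB+4L$, $$\mathcal{F}=\log\left(1+\frac{(X\overline{\Delta}_1+2C)T+X\left(3\eta\|\nabla f(x_1)\|+\frac{9L\eta^2}{2}\right)T^2+\frac{9L\eta^2}{2}XT^3}{G_0^2}\right),$$ $$\overline{\Delta}_L=4\overline{\Delta}_1+8L\eta^2\mathcal{F}+36\eta^2(A+2BL)\log^2\frac T\delta+12\eta\sqrt C\log\frac T\delta+64\eta^2(A+2BL)\mathcal{F}^2+16\eta\sqrt C\mathcal{F}+10L\eta^2.$$ Then, with probability at least $1-\delta$, $$\frac1T\sum_{t=1}^T\|\nabla f(\overline{x}_t)\|^2\le\left(\frac{3\overline{\Delta}_LG_0}{\eta}+\frac{9\overline{\Delta}_L^2}{2\eta^2}(B+1)\right)\frac1T+\frac{3\overline{\Delta}_L}{\eta\sqrt T}\sqrt{2(A\overline{\Delta}_L+C)}.$$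
   Context: Notation: $\|\cdot\|$ is the Euclidean norm on $\mathbb{R}^d$, $[T]=\{1,\dots,T\}$, $\log$ is the natural logarithm. The objective is $f(x)=\mathbb{E}_{z\sim\mathcal D}[f_z(x;z)]$, differentiable, with stochastic gradient oracle $\nabla f_z(x;z)$; $z_1,\dots,z_T$ are independent samples from $\mathcal D$. $L$-smoothness ($L>0$): $\|\nabla f(x)-\nabla f(y)\|\le L\|x-y\|$ for all $x,y\in\mathbb{R}^d$. Assumption 1: $f^*:=\inf_{x}f(x)>-\infty$. Assumption 2: $\mathbb{E}_z[\nabla f_z(x;z)]=\nabla f(x)$ for all $x$. Assumption 3: for constants $A,B,C>0$, for all $x$, almost surely $\|\nabla f_z(x;z)-\nabla f(x)\|^2\le A(f(x)-f^* )+B\|\nabla f(x)\|^2+C$. Generic AGD template: given (deterministic) $\tilde x_1=x_1\in\mathbb{R}^d$, $\alpha_t\in(0,1]$ and step sizes $\theta_t,\gamma_t$, for $t=1,\dots,T$: $\overline{x}_t=\alpha_tx_t+(1-\alpha_t)\tilde x_t$; $g_t=\nabla f_z(\overline{x}_t;z_t)$; $x_{t+1}=x_t-\theta_tg_t$; $\tilde x_{t+1}=\overline{x}_t-\gamma_tg_t$ (in particular $\overline{x}_1=x_1$). RSAG with adaptive step size: $\theta_t=\eta_t$, $\alpha_t=\frac{2}{t+1}$, $\gamma_t=(1+\alpha_t)\theta_t$. AdaGrad-Norm: $\gamma_t=\theta_t=\eta_t$ (so $\overline{x}_t=x_t$). Here $\eta_t=\eta/(G_0^2+\sum_{k=1}^t\|g_k\|^2)^{1/2}$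 with constants $\eta,G_0>0$. *)

(* Defs.v *)
(* MathComp-Analysis *)
From HB Require Import structures.
From mathcomp Require Import all_boot all_order all_algebra.
From mathcomp Require Import all_classical all_reals all_analysis.

Set Implicit Arguments.
Unset Strict Implicit.
Unset Printing Implicit Defensive.

Import Order.TTheory GRing.Theory Num.Theory.
Import numFieldNormedType.Exports.

Local Open Scope classical_set_scope.
Local Open Scope ring_scope.

(* The library norm `|v| on 'rV[R]_d is the sup norm, hence this one. *)
Definition enorm (R : realType) (d : nat) (v : 'rV[R]_d) : R :=
  Num.sqrt (\sum_(i < d) v 0 i ^+ 2).

(* Only meaningful at points where f is differentiable; ['D_v f x] is a default
   value when the directional derivative does not exist. *)
Definition grad (R : realType) (d : nat) (f : 'rV[R]_d -> R) (x : 'rV[R]_d) :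
    'rV[R]_d :=
  \row_(i < d) 'D_(delta_mx 0 i) f x.

Definition smooth (R : realType) (d : nat) (L : R) (f : 'rV[R]_d -> R) : Prop :=
  (forall x, differentiable f x) /\
  (forall x y, enorm (grad f x - grad f y) <= L * enorm (x - y)).

Definition borel_rV (R : realType) (d : nat) :=
  g_sigma_algebraType (@open 'rV[R]_d).

(* Explicit integrability, because the library expectation is total. *)
Definition has_mean (dZ : measure_display) (Z : measurableType dZ)
    (R : realType) (D : probability Z R) (X : Z -> R) (m : R) : Prop :=
  D.-integrable [set: Z] (EFin \o X) /\ 'E_D[X]%E = m%:E.

(* G is the oracle (x, z) |-> \nabla f_z(x; z). It is jointly measurable, so
   that the iterates and the g_t are random variables, and it returns the
   gradient of f_z(.; z) at every point where that gradient exists; the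
   functions f_z(.; z) themselves need not be differentiable everywhere. *)
Definition gradient_oracle (dZ : measure_display) (Z : measurableType dZ)
    (R : realType) (d : nat) (fz : 'rV[R]_d -> Z -> R)
    (G : 'rV[R]_d -> Z -> 'rV[R]_d) : Prop :=
  (forall i : 'I_d, measurable_fun [set: borel_rV R d * Z]
     (fun p : borel_rV R d * Z => G p.1 p.2 0 i)) /\
  (forall x z, differentiable (fz ^~ z) x -> G x z = grad (fz ^~ z) x).

Definition unbiased (dZ : measure_display) (Z : measurableType dZ)
    (R : realType) (d : nat) (D : probability Z R) (f : 'rV[R]_d -> R)
    (G : 'rV[R]_d -> Z -> 'rV[R]_d) : Prop :=
  forall (x : 'rV[R]_d) (i : 'I_d),
    has_mean D (fun z => G x z 0 i) (grad f x 0 i).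

Definition affine_noise (dZ : measure_display) (Z : measurableType dZ)
    (R : realType) (d : nat) (D : probability Z R) (f : 'rV[R]_d -> R)
    (G : 'rV[R]_d -> Z -> 'rV[R]_d) (A B C : R) : Prop :=
  forall x : 'rV[R]_d, {ae D, forall z,
    enorm (G x z - grad f x) ^+ 2 <=
      A * (f x - inf (range f)) + B * enorm (grad f x) ^+ 2 + C}.

Definition mutually_independent (dO dZ : measure_display)
    (Omega : measurableType dO) (Z : measurableType dZ) (R : realType)
    (P : probability Omega R) (I : finType) (z : I -> Omega -> Z) : Prop :=
  forall (J : {set I}) (S : I -> set Z),
    (forall t, t \in J -> measurable (S t)) ->
    P (\bigcap_(t in [set` J]) (z t @^-1` S t)) =
    (\prod_(t in J) P (z t @^-1` S t))%E.

(* z_1, ..., z_T are independent with law D; the index 0 and the indices beyond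
   T are not constrained. *)
Definition iid_samples (dO dZ : measure_display)
    (Omega : measurableType dO) (Z : measurableType dZ) (R : realType)
    (P : probability Omega R) (D : probability Z R) (T : nat)
    (z : nat -> {RV P >-> Z}) : Prop :=
  mutually_independent P (fun (t : 'I_T) => z t.+1 : Omega -> Z) /\
  (forall t, (1 <= t <= T)%N ->
   forall S : set Z, measurable S -> distribution P (z t) S = D S).

(* One trajectory of the generic template, with times numbered from 1:
   x, xt, xb stand for x_t, \tilde x_t, \overline x_t, and h t is the oracle
   queried at time t. *)
Record agd (R : realType) (d T : nat) (alpha theta gamma : nat -> R)
    (h : nat -> 'rV[R]_d -> 'rV[R]_d) (x1 : 'rV[R]_d)
    (x xt xb g : nat -> 'rV[R]_d) : Prop := Agd {
  agd_x_init : x 1%N = x1;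
  agd_xt_init : xt 1%N = x1;
  agd_xb : forall t, (1 <= t <= T)%N ->
    xb t = alpha t *: x t + (1 - alpha t) *: xt t;
  agd_g : forall t, (1 <= t <= T)%N -> g t = h t (xb t);
  agd_x : forall t, (1 <= t <= T)%N -> x t.+1 = x t - theta t *: g t;
  agd_xt : forall t, (1 <= t <= T)%N -> xt t.+1 = xb t - gamma t *: g t }.

Definition adaptive_step (R : realType) (d : nat) (eta G0 : R)
    (g : nat -> 'rV[R]_d) (t : nat) : R :=
  eta / Num.sqrt (G0 ^+ 2 + \sum_(1 <= k < t.+1) enorm (g k) ^+ 2).

Definition adagrad_norm (R : realType) (d T : nat) (eta G0 : R)
    (alpha : nat -> R) (h : nat -> 'rV[R]_d -> 'rV[R]_d) (x1 : 'rV[R]_d)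
    (x xt xb g : nat -> 'rV[R]_d) : Prop :=
  agd T alpha (adaptive_step eta G0 g) (adaptive_step eta G0 g)
    h x1 x xt xb g.

Definition rsag_alpha (R : realType) (t : nat) : R := 2 / (t%:R + 1).

Definition rsag (R : realType) (d T : nat) (eta G0 : R)
    (h : nat -> 'rV[R]_d -> 'rV[R]_d) (x1 : 'rV[R]_d)
    (x xt xb g : nat -> 'rV[R]_d) : Prop :=
  agd T (@rsag_alpha R) (adaptive_step eta G0 g)
    (fun t => (1 + rsag_alpha R t) * adaptive_step eta G0 g t)
    h x1 x xt xb g.

(* Main.v *)
(* With v_t the gradient and g_t the stochastic gradient at the averaged iterate,
   N_t^2 the noise level there and S_t = G0^2 + sum_(k <= t) |g_k|^2, replace
   eta_t by the predictable proxy eta / sqrt(S_(t-1) + |v_t|^2 + N_t^2). The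
   error of the replacement costs 1/6 of the gradient term plus
   4 eta N_t |g_t|^2 / S_t, whose sum is logarithmic in S_T; and S_T grows
   polynomially since every step has length at most eta.

   The remaining martingale is stopped when f exceeds its infimum by more than
   DeltaL, so that N_t <= M. With lambda = 1 / (3 eta M) its scaled increments
   are at most 1/3, where exp y <= 1 + y + y^2, so the exponential of the
   compensated sum has expectation at most 1. Markov's inequality and a union
   bound over t <= T cost 3 eta M ln(T / delta) and 1/3 of the gradient term.

   On this event, induction on t shows that f never exceeds its infimum by more
   than DeltaL, because M^2 is affine in DeltaL and AM-GM absorbs it. The
   surviving half of the gradient term gives a quadratic inequality for the
   square root of sum_t |v_t|^2. *)
Require Import Defs.
From HB Require Import structures.
From mathcomp Require Import all_boot all_order all_algebra.
From mathcomp Require Import all_classical all_reals all_analysis.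
From mathcomp Require Import measurable_realfun.
From mathcomp Require Import ring lra.

Set Implicit Arguments.
Unset Strict Implicit.
Unset Printing Implicit Defensive.

Import Order.TTheory GRing.Theory Num.Theory.
Import numFieldNormedType.Exports.

Local Open Scope classical_set_scope.
Local Open Scope ring_scope.

(** * Euclidean norm and smooth functions *)

Definition dot (R : realType) (d : nat) (u v : 'rV[R]_d) : R :=
  \sum_(i < d) u 0 i * v 0 i.

Section Euclidean.
Context {R : realType} {d : nat}.
Implicit Types (u v w : 'rV[R]_d) (a : R).

Lemma dotC u v : dot u v = dot v u.
Proof. by apply: eq_bigr => i _; rewrite mulrC. Qed.

Lemma dotDl u v w : dot (u + v) w = dot u w + dot v w.
Proof. by rewrite -big_split; apply: eq_bigr => i _; rewrite mxE mulrDl. Qed.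

Lemma dotZl a u w : dot (a *: u) w = a * dot u w.
Proof. by rewrite mulr_sumr; apply: eq_bigr => i _; rewrite mxE mulrA. Qed.

Lemma dotNl u w : dot (- u) w = - dot u w.
Proof. by rewrite -scaleN1r dotZl mulN1r. Qed.

Lemma dotBl u v w : dot (u - v) w = dot u w - dot v w.
Proof. by rewrite dotDl dotNl. Qed.

Lemma dotDr u v w : dot w (u + v) = dot w u + dot w v.
Proof. by rewrite dotC dotDl !(dotC w). Qed.

Lemma dotZr a u w : dot w (a *: u) = a * dot w u.
Proof. by rewrite dotC dotZl (dotC w). Qed.

Lemma dotNr u w : dot w (- u) = - dot w u.
Proof. by rewrite dotC dotNl (dotC w). Qed.

Lemma dotBr u v w : dot w (u - v) = dot w u - dot w v.
Proof. by rewrite dotDr dotNr. Qed.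

Lemma dot_ge0 u : 0 <= dot u u.
Proof. by apply: sumr_ge0 => i _; rewrite -expr2 sqr_ge0. Qed.

Lemma enorm_ge0 u : 0 <= enorm u.
Proof. exact: sqrtr_ge0. Qed.

Lemma enorm_sqr u : enorm u ^+ 2 = dot u u.
Proof.
rewrite sqr_sqrtr; last by apply: sumr_ge0 => i _; rewrite sqr_ge0.
by apply: eq_bigr => i _; rewrite expr2.
Qed.

Lemma enorm0 : enorm (0 : 'rV[R]_d) = 0.
Proof. by rewrite /enorm big1 ?sqrtr0// => i _; rewrite mxE expr0n. Qed.

Lemma enormZ a u : enorm (a *: u) = `|a| * enorm u.
Proof.
rewrite /enorm -sqrtr_sqr -sqrtrM ?sqr_ge0// mulr_sumr.
by congr Num.sqrt; apply: eq_bigr => i _; rewrite mxE exprMn.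
Qed.

Lemma enormN u : enorm (- u) = enorm u.
Proof. by rewrite -scaleN1r enormZ normrN normr1 mul1r. Qed.

Lemma enormB u v : enorm (u - v) = enorm (v - u).
Proof. by rewrite -enormN opprB. Qed.

Lemma enorm_eq0 u : enorm u = 0 -> u = 0.
Proof.
move=> /(congr1 (fun a => a ^+ 2)); rewrite enorm_sqr expr0n /= => /eqP.
rewrite psumr_eq0 => [/allP u0|i _]; last by rewrite -expr2 sqr_ge0.
apply/rowP => i; rewrite mxE; apply/eqP.
by have := u0 i (mem_index_enum _); rewrite mulf_eq0 orbb.
Qed.

(** Cauchy-Schwarz without division: expand the squared norm of [enorm v ^+ 2 *: u - dot u v *: v]
    and cancel the factor [enorm v ^+ 2], positive unless [v] vanishes. *)
Lemma dot_le_enorm u v : `|dot u v| <= enorm u * enorm v.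
Proof.
have [/eqP/enorm_eq0 ->|v0] := boolP (enorm v == 0).
  by rewrite enorm0 mulr0 -(scale0r 0) dotZr mul0r normr0.
have v2 : 0 < enorm v ^+ 2 by rewrite exprn_even_gt0.
rewrite -(@ler_pXn2r _ 2) ?nnegrE ?mulr_ge0 ?enorm_ge0// real_normK ?num_real//.
rewrite exprMn -(ler_pM2l v2).
have := dot_ge0 (enorm v ^+ 2 *: u - dot u v *: v).
rewrite !(dotBl, dotBr, dotZl, dotZr) -!enorm_sqr (dotC v u).
move: (dot u v) (enorm u) (enorm v) => p a b; lra.
Qed.

Lemma enormD u v : enorm (u + v) <= enorm u + enorm v.
Proof.
rewrite -(@ler_pXn2r _ 2) ?nnegrE ?addr_ge0 ?enorm_ge0//.
rewrite sqrrD !enorm_sqr dotDl !dotDr (dotC v u).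
have := dot_le_enorm u v; have := ler_norm (dot u v); lra.
Qed.

Lemma enorm_dist u v : `|enorm u - enorm v| <= enorm (u - v).
Proof.
have := enormD (u - v) v; have := enormD (v - u) u.
by rewrite !subrK enormB ler_norml => *; apply/andP; split; lra.
Qed.

End Euclidean.

Section Smooth.
Context {R : realType} {d : nat} (L : R) (f : 'rV[R]_d -> R).
Context (L_gt0 : 0 < L) (f_smooth : smooth L f).
Implicit Types x y h : 'rV[R]_d.

Lemma derive_grad x h : differentiable f x -> 'D_h f x = dot (grad f x) h.
Proof.
move=> fx; rewrite deriveE// {1}(row_sum_delta h) linear_sum.
by apply: eq_bigr => i _; rewrite linearZ /= mxE mulrC deriveE.
Qed.

Lemma is_derive_line x h (s : R) :
  is_derive s 1 (fun r : R => f (x + r *: h)) (dot (grad f (x + s *: h)) h).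
Proof.
have df := f_smooth.1 (x + s *: h).
have e : (fun t : R => t^-1 *: (f (x + (t *: 1 + s) *: h) - f (x + s *: h))) =
    (fun t : R => t^-1 *: (f (t *: h + (x + s *: h)) - f (x + s *: h))).
  by apply/funext => t; rewrite scalerDl addrCA -scalerA scale1r.
split; first by rewrite /derivable /= e; exact: diff_derivable.
by rewrite -derive_grad// /derive /= e.
Qed.

(** Up to a constant, [q] is [f] along the segment minus its claimed quadratic majorant. Its
    derivative is nonpositive by Cauchy-Schwarz and the Lipschitz gradient, so comparing [q 1] with
    [q 0] replaces an integration. *)
Lemma descent x y :
  f y <= f x + dot (grad f x) (y - x) + L / 2 * enorm (y - x) ^+ 2.
Proof.
set h := y - x; pose phi s := f (x + s *: h).
pose q s := phi s - dot (grad f x) h * s - L / 2 * enorm h ^+ 2 * s ^+ 2.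
have dq (s : R) : is_derive s 1 q
    (dot (grad f (x + s *: h)) h - dot (grad f x) h - L * enorm h ^+ 2 * s).
  have := is_derive_line x h s; rewrite -/phi => dphi.
  by apply: is_derive_eq; rewrite /GRing.scale /=; field.
have q01 : q 1 <= q 0.
  apply: (@ler0_derive1_nincr _ q 0 1) => //.
  - move=> s; rewrite in_itv /= => /andP[s0 s1].
    rewrite derive1E derive_val -dotBl.
    have := f_smooth.2 (x + s *: h) x.
    rewrite [X in _ * enorm X]addrAC subrr add0r enormZ gtr0_norm// => Lsh.
    rewrite subr_le0. apply: le_trans (ler_norm _) _.
    apply: le_trans (dot_le_enorm _ _) _.
    apply: le_trans (ler_wpM2r (enorm_ge0 h) Lsh) _.
    lra.
  - by apply: derivable_within_continuous => s _.
have xh : x + h = y by rewrite addrC subrK.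
by move: q01; rewrite /q /phi scale1r scale0r addr0 xh expr1n expr0n /=; lra.
Qed.

(** A gradient step of size [L^-1] lowers [f] by at least the squared gradient norm over [2 * L],
    and cannot lead below [fstar]. *)
Lemma grad_sqr_le (fstar : R) x : (forall y, fstar <= f y) ->
  enorm (grad f x) ^+ 2 <= 2 * L * (f x - fstar).
Proof.
move=> fs; have := descent x (x - L^-1 *: grad f x).
rewrite (addrC x) addrK dotNr dotZr enormN enormZ exprMn -enorm_sqr.
rewrite gtr0_norm ?invr_gt0// => fL; have := le_trans (fs _) fL.
move: (enorm _ ^+ 2) => g h; rewrite -subr_ge0.
have -> : 2 * L * (f x - fstar) - g =
  2 * L * (f x + - (L^-1 * g) + L / 2 * (L^-1 ^+ 2 * g) - fstar).
  by field; rewrite gt_eqF.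
by rewrite mulr_ge0 ?subr_ge0// mulr_ge0// ltW.
Qed.

End Smooth.

(** * Scalar inequalities for the step-size proxy and the logarithmic sum *)

Section ScalarEstimates.
Context {R : realType}.
Implicit Types S N v g p : R.

(** Squares are compared, using that each root dominates its own [g] or [v]. The worse direction
    leaves [2 * N ^+ 2], one from [(g + N) ^+ 2] and one from the proxy, and [(3 / 2) ^+ 2] exceeds
    2. *)
Lemma sqrt_proxy_dist S N v g : 0 <= S -> 0 <= N -> 0 <= v -> 0 <= g ->
  `|v - g| <= N ->
  `|Num.sqrt (S + g ^+ 2) - Num.sqrt (S + v ^+ 2 + N ^+ 2)| <= 3 / 2 * N.
Proof.
move=> S0 N0 v0 g0; rewrite ler_norml => /andP[vg gv].
have ha : 0 <= S + g ^+ 2 by rewrite addr_ge0 ?sqr_ge0.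
have hb : 0 <= S + v ^+ 2 + N ^+ 2 by rewrite !addr_ge0 ?sqr_ge0.
have ga : g <= Num.sqrt (S + g ^+ 2).
  by rewrite -{1}(ger0_norm g0) -sqrtr_sqr ler_wsqrtr// lerDr.
have vb : v <= Num.sqrt (S + v ^+ 2 + N ^+ 2).
  by rewrite -{1}(ger0_norm v0) -sqrtr_sqr ler_wsqrtr//; have := sqr_ge0 N; lra.
have := sqr_sqrtr ha; have := sqr_sqrtr hb.
have := sqrtr_ge0 (S + g ^+ 2); have := sqrtr_ge0 (S + v ^+ 2 + N ^+ 2).
move: vb ga; move: (Num.sqrt (S + v ^+ 2 + N ^+ 2)) (Num.sqrt (S + g ^+ 2)).
move=> b a vb ga b0 a0 b2 a2; rewrite ler_norml; apply/andP; split.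
- have : b ^+ 2 <= (a + 3 / 2 * N) ^+ 2.
    have : v ^+ 2 <= (g + N) ^+ 2 by rewrite ler_pXn2r ?nnegrE//; lra.
    have : g * N <= a * N by rewrite ler_wpM2r.
    have : 0 <= a * N by rewrite mulr_ge0.
    have := sqr_ge0 N; rewrite !expr2; rewrite !expr2 in a2 b2; lra.
  by rewrite ler_pXn2r ?nnegrE//; lra.
- have : a ^+ 2 <= (b + 3 / 2 * N) ^+ 2.
    have : g ^+ 2 <= (v + N) ^+ 2 by rewrite ler_pXn2r ?nnegrE//; lra.
    have : v * N <= b * N by rewrite ler_wpM2r.
    have : 0 <= b * N by rewrite mulr_ge0.
    have := sqr_ge0 N; rewrite !expr2; rewrite !expr2 in a2 b2; lra.
  by rewrite ler_pXn2r ?nnegrE//; lra.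
Qed.

(* Replacing the step size [1 / sqrt (S + g^2)], which depends on the current
   sample, by a proxy that does not. *)
Lemma proxy_step_error S N v g p : 0 < S -> 0 <= N -> 0 <= v -> 0 <= g ->
  `|v - g| <= N -> `|p| <= v * g ->
  ((Num.sqrt (S + v ^+ 2 + N ^+ 2))^-1 - (Num.sqrt (S + g ^+ 2))^-1) * p <=
  6^-1 * (v ^+ 2 / Num.sqrt (S + v ^+ 2 + N ^+ 2))
  + 4 * N * (g ^+ 2 / (S + g ^+ 2)).
Proof.
move=> S0 N0 v0 g0 vgN pvg.
have := sqrt_proxy_dist (ltW S0) N0 v0 g0 vgN.
set b := Num.sqrt (S + v ^+ 2 + N ^+ 2); set a := Num.sqrt (S + g ^+ 2).
have a0 : 0 < a by rewrite sqrtr_gt0 ltr_pwDl// sqr_ge0.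
have b0 : 0 < b.
  by rewrite sqrtr_gt0 -addrA ltr_pwDl// addr_ge0 ?sqr_ge0.
have Nb : N <= b.
  rewrite -{1}(ger0_norm N0) -sqrtr_sqr ler_wsqrtr//.
  by have := sqr_ge0 v; lra.
have -> : S + g ^+ 2 = a ^+ 2.
  by rewrite sqr_sqrtr// addr_ge0 ?sqr_ge0// ltW.
move=> ab; apply: le_trans (ler_norm _) _; rewrite normrM.
have -> : b^-1 - a^-1 = (a - b) / (a * b).
  by field; rewrite !gt_eqF.
rewrite normrM (@gtr0_norm _ (a * b)^-1) ?invr_gt0 ?mulr_gt0//.
have h : `|a - b| / (a * b) * `|p| <= 3 / 2 * N / (a * b) * (v * g).
  by rewrite ler_pM ?mulr_ge0 ?invr_ge0// ?ler_wpM2r ?invr_ge0 ?mulr_ge0// ltW.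
(* Young's inequality splits [v * y] so that [v ^+ 2] gets the coefficient [6^-1]; then [y ^+ 2] has
   [27 / 8], rounded up to 4. A factor [N / b], at most 1, is dropped. *)
apply: le_trans h _; have [y yE] : exists y, y = N * g / a by exists (N * g / a).
have -> : 3 / 2 * N / (a * b) * (v * g) = b^-1 * (3 / 2 * v * y).
  by rewrite yE; field; rewrite !gt_eqF.
have : b^-1 * (3 / 2 * v * y) <= b^-1 * (6^-1 * v ^+ 2 + 27 / 8 * y ^+ 2).
  rewrite ler_wpM2l ?invr_ge0 ?(ltW b0)//.
  by have := sqr_ge0 (v / 3 - 3 / 2 * y); rewrite !expr2; lra.
have : b^-1 * y ^+ 2 <= N * (g ^+ 2 / a ^+ 2).
  have -> : b^-1 * y ^+ 2 = N / b * (N * (g ^+ 2 / a ^+ 2)).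
    by rewrite yE; field; rewrite !gt_eqF.
  apply: ler_piMl; first by rewrite mulr_ge0 ?divr_ge0 ?sqr_ge0.
  by rewrite ler_pdivrMr// mul1r.
have : 0 <= N * (g ^+ 2 / a ^+ 2) by rewrite mulr_ge0 ?divr_ge0 ?sqr_ge0.
by rewrite !expr2; lra.
Qed.

(* [1 - 1/x <= ln x], telescoped *)
Lemma sum_ratio_le_ln (u : nat -> R) (G0 : R) t : 0 < G0 ->
  (forall k, 0 <= u k) ->
  \sum_(1 <= k < t.+1) (u k / (G0 + \sum_(1 <= i < k.+1) u i))
  <= ln ((G0 + \sum_(1 <= i < t.+1) u i) / G0).
Proof.
move=> G0_gt0 u0.
have S_gt0 n : 0 < G0 + \sum_(1 <= i < n.+1) u i.
  by rewrite ltr_pwDl// sumr_ge0.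
elim: t => [|t IH]; first by rewrite !big_geq// addr0 divff ?gt_eqF// ln1.
rewrite big_nat_recr//= [X in X / G0](_ : _ = (G0 + \sum_(1 <= i < t.+2) u i))//.
set S' := G0 + \sum_(1 <= i < t.+2) u i.
set S := G0 + \sum_(1 <= i < t.+1) u i in IH.
have SS' : u t.+1 = S' - S by rewrite /S' /S big_nat_recr//=; ring.
have -> : S' / G0 = (S / G0) * (S' / S) by field; rewrite !gt_eqF// S_gt0.
rewrite lnM ?posrE ?divr_gt0 ?S_gt0// lerD// SS' mulrBl divff ?gt_eqF ?S_gt0//.
rewrite -[S' / S]invf_div lnV ?posrE ?divr_gt0 ?S_gt0//.
have := @le_ln1Dx R (S / S' - 1); rewrite addrCA subrr addr0 => h.
by rewrite lerNr opprB h// ltrBrDl addrN divr_gt0 ?S_gt0.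
Qed.

End ScalarEstimates.

(** * Pathwise estimate *)

Definition noise_level (R : realType) (d : nat) (f : 'rV[R]_d -> R)
    (fs A B C : R) (y : 'rV[R]_d) : R :=
  A * (f y - fs) + B * enorm (grad f y) ^+ 2 + C.

Definition gsum (R : realType) (d : nat) (G0 : R) (g : nat -> 'rV[R]_d)
    (t : nat) : R :=
  G0 ^+ 2 + \sum_(1 <= k < t.+1) enorm (g k) ^+ 2.

Definition proxy_step (R : realType) (d : nat) (f : 'rV[R]_d -> R)
    (fs A B C eta S : R) (y : 'rV[R]_d) : R :=
  eta / Num.sqrt (S + enorm (grad f y) ^+ 2 + noise_level f fs A B C y).

Section Path.
Context {R : realType} {d : nat} (L : R) (f : 'rV[R]_d -> R) (fs : R).
Context (T : nat) (eta G0 A B C : R) (x1 : 'rV[R]_d).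
Context (x xb g : nat -> 'rV[R]_d).
Context (L_gt0 : 0 < L) (f_smooth : smooth L f) (fs_le : forall y, fs <= f y).
Context (T_gt0 : (0 < T)%N) (eta_gt0 : 0 < eta) (G0_gt0 : 0 < G0).
Context (A_gt0 : 0 < A) (B_gt0 : 0 < B) (C_gt0 : 0 < C).

Local Notation v t := (grad f (xb t)).
Local Notation nz t := (noise_level f fs A B C (xb t)).
Local Notation S := (gsum G0 g).
Local Notation et := (adaptive_step eta G0 g).
Local Notation he t := (proxy_step f fs A B C eta (S t.-1) (xb t)).

Context (x_init : x 1%N = x1).
Context (x_step : forall t, (1 <= t <= T)%N -> x t.+1 = x t - et t *: g t).
(** Averaging enters the pathwise argument only through these two bounds on the lag, which
    AdaGrad-Norm and RSAG share. *)
Context (lag_le : forall t, (1 <= t <= T)%N -> enorm (xb t - x t) <= eta).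
Context (lag_sum : forall t, (1 <= t <= T)%N ->
  \sum_(1 <= k < t.+1) enorm (xb k - x k) ^+ 2 <=
  2 * \sum_(1 <= k < t.+1) (et k ^+ 2 * enorm (g k) ^+ 2)).
Context (noise : forall t, (1 <= t <= T)%N -> enorm (g t - v t) ^+ 2 <= nz t).

Lemma gsum_gt0 t : 0 < S t.
Proof. by rewrite ltr_pwDl ?exprn_gt0// sumr_ge0// => k _; rewrite sqr_ge0. Qed.

Lemma gsumS t : S t.+1 = S t + enorm (g t.+1) ^+ 2.
Proof. by rewrite /gsum big_nat_recr//= addrA. Qed.

Lemma gap_ge0 y : 0 <= f y - fs.
Proof. by rewrite subr_ge0. Qed.

Lemma noise_level_gt0 y : 0 < noise_level f fs A B C y.
Proof.
by rewrite /noise_level ltr_wpDl// addr_ge0 ?mulr_ge0 ?gap_ge0 ?enorm_ge0// ltW.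
Qed.

Lemma adaptive_step_gt0 t : 0 < et t.
Proof. by rewrite divr_gt0 ?sqrtr_gt0 ?gsum_gt0. Qed.

Lemma proxy_arg_gt0 t : 0 < S t.-1 + enorm (v t) ^+ 2 + nz t.
Proof. by rewrite addr_gt0 ?noise_level_gt0// ltr_pwDl ?gsum_gt0// sqr_ge0. Qed.

Lemma proxy_step_gt0 t : 0 < he t.
Proof. by rewrite divr_gt0 ?sqrtr_gt0 ?proxy_arg_gt0. Qed.

Lemma adaptive_step_sqr t :
  et t ^+ 2 * enorm (g t) ^+ 2 = eta ^+ 2 * (enorm (g t) ^+ 2 / S t).
Proof.
rewrite /adaptive_step -/(S t) expr_div_n sqr_sqrtr ?ltW ?gsum_gt0//.
by rewrite mulrAC mulrA.
Qed.

Lemma adaptive_step_le t : (0 < t)%N -> et t * enorm (g t) <= eta.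
Proof.
case: t => // t _; rewrite /adaptive_step -/(S t.+1) mulrAC.
rewrite ler_pdivrMr ?sqrtr_gt0 ?gsum_gt0//.
rewrite ler_wpM2l ?(ltW eta_gt0)// -{1}(ger0_norm (enorm_ge0 (g _))) -sqrtr_sqr.
by rewrite ler_wsqrtr// gsumS lerDr ltW// gsum_gt0.
Qed.

Lemma x_dist t : (t <= T)%N -> enorm (x t.+1 - x1) <= t%:R * eta.
Proof.
elim: t => [|t IH] tT; first by rewrite x_init subrr enorm0 mul0r.
rewrite x_step//= addrAC; apply: le_trans (enormD _ _) _.
rewrite enormN enormZ gtr0_norm ?adaptive_step_gt0//.
by have := IH (ltnW tT); have := adaptive_step_le (ltn0Sn t); rewrite -natr1; lra.
Qed.

(** At most [T - 1] steps and one lag, each of length at most [eta], separate [xb t] from [x1],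
    whatever the noise. This crude bound serves to dominate the logarithm of [S t] by the
    deterministic [F]. *)
Lemma gap_growth t : (1 <= t <= T)%N ->
  f (xb t) - fs <= f x1 - fs + T%:R * eta * enorm (grad f x1)
    + L / 2 * (T%:R * eta) ^+ 2.
Proof.
case: t => // t /andP[_ tT].
have dist : enorm (xb t.+1 - x1) <= T%:R * eta.
  rewrite -(subrK (x t.+1) (xb t.+1)) -addrA; apply: le_trans (enormD _ _) _.
  have := x_dist (ltnW tT); have := @lag_le t.+1 tT.
  have : t.+1%:R * eta <= T%:R * eta by rewrite ler_pM2r// ler_nat.
  by rewrite -natr1; lra.
have := descent f_smooth x1 (xb t.+1).
have := dot_le_enorm (grad f x1) (xb t.+1 - x1).
have := ler_norm (dot (grad f x1) (xb t.+1 - x1)).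
have : enorm (grad f x1) * enorm (xb t.+1 - x1) <= enorm (grad f x1) * (T%:R * eta).
  by rewrite ler_wpM2l ?enorm_ge0.
have : L / 2 * enorm (xb t.+1 - x1) ^+ 2 <= L / 2 * (T%:R * eta) ^+ 2.
  rewrite ler_wpM2l ?divr_ge0// ?(ltW L_gt0)// ler_pXn2r ?nnegrE ?enorm_ge0//.
  by rewrite mulr_ge0// ltW.
lra.
Qed.

Let n : R := T%:R.
Let Delta1 := f x1 - fs.
(** By [grad_sqr_le], [2 * nz t + 2 * enorm (v t) ^+ 2] is at most [X] times the gap plus
    [2 * C]. *)
Let X := 2 * A + 4 * L * B + 4 * L.
Let F := ln (1 +
    ((X * Delta1 + 2 * C) * n
     + X * (3 * eta * enorm (grad f x1) + 9 * L * eta ^+ 2 / 2) * n ^+ 2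
     + 9 * L * eta ^+ 2 / 2 * X * n ^+ 3) / G0 ^+ 2).

Lemma grad_sqr_le_gap t : enorm (v t) ^+ 2 <= 2 * L * (f (xb t) - fs).
Proof. exact: grad_sqr_le. Qed.

Lemma sqrt_noise_level_le y K : f y - fs <= K ->
  Num.sqrt (noise_level f fs A B C y) <= Num.sqrt ((A + 2 * B * L) * K + C).
Proof.
move=> yK; rewrite ler_wsqrtr// lerD2r.
have := ler_wpM2l (ltW B_gt0) (grad_sqr_le L_gt0 f_smooth y fs_le).
have k0 : 0 <= A + 2 * B * L by rewrite addr_ge0 ?mulr_ge0// ltW.
by have := ler_wpM2l k0 yK; lra.
Qed.

Lemma stoch_grad_sqr_le t : (1 <= t <= T)%N ->
  enorm (g t) ^+ 2 <= 2 * nz t + 2 * enorm (v t) ^+ 2.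
Proof.
move=> tT; have := noise tT; have := enormD (g t - v t) (v t); rewrite subrK.
have := enorm_ge0 (g t); have := enorm_ge0 (g t - v t).
move: (enorm (g t)) (enorm (g t - v t)) (enorm (v t)) (nz t) => a b c N b0 a0.
move=> abc bN; have : a ^+ 2 <= (b + c) ^+ 2 by rewrite ler_pXn2r ?nnegrE//; lra.
by have := sqr_ge0 (b - c); rewrite !expr2; rewrite expr2 in bN; lra.
Qed.

Lemma X_gt0 : 0 < X.
Proof. by rewrite !addr_gt0 ?mulr_gt0. Qed.

Lemma poly_ge0 : 0 <= (X * Delta1 + 2 * C) * n
     + X * (3 * eta * enorm (grad f x1) + 9 * L * eta ^+ 2 / 2) * n ^+ 2
     + 9 * L * eta ^+ 2 / 2 * X * n ^+ 3.
Proof.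
have X0 := ltW X_gt0; have n0 : 0 <= n by [].
have XD : 0 <= X * Delta1 + 2 * C.
  by rewrite addr_ge0 ?mulr_ge0 ?gap_ge0// ltW.
have Le : 0 <= 9 * L * eta ^+ 2 / 2.
  by rewrite divr_ge0// !mulr_ge0// ltW.
have e0 : 0 <= 3 * eta * enorm (grad f x1) by rewrite !mulr_ge0 ?enorm_ge0// ltW.
have := mulr_ge0 XD n0.
have := mulr_ge0 (mulr_ge0 X0 (addr_ge0 e0 Le)) (exprn_ge0 2 n0).
have := mulr_ge0 (mulr_ge0 Le X0) (exprn_ge0 3 n0).
lra.
Qed.

Lemma F_ge0 : 0 <= F.
Proof. by rewrite ln_ge0// lerDl divr_ge0 ?sqr_ge0// poly_ge0. Qed.

Lemma sum_ratio_le_F t : (t <= T)%N ->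
  \sum_(1 <= k < t.+1) (enorm (g k) ^+ 2 / S k) <= F.
Proof.
move=> tT; apply: le_trans (sum_ratio_le_ln t (exprn_gt0 2 G0_gt0) _) _.
  by move=> k; rewrite sqr_ge0.
have G2 : 0 < G0 ^+ 2 by rewrite exprn_gt0.
rewrite ler_ln ?posrE ?divr_gt0 ?(gsum_gt0 t)//; last first.
  by rewrite ltr_pwDl// divr_ge0 ?poly_ge0 ?(ltW G2)//.
rewrite mulrDl divff ?gt_eqF// lerD2l ler_pM2r ?invr_gt0//.
(* A bound for a single [enorm (g k) ^+ 2], from the definition of [X] and [gap_growth]. *)
pose q := X * (Delta1 + n * eta * enorm (grad f x1) + L / 2 * (n * eta) ^+ 2) + 2 * C.
have D0 : 0 <= Delta1 := gap_ge0 x1.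
have X0 := X_gt0; have n0 : 0 <= n by [].
have Le : 0 <= L / 2 * (n * eta) ^+ 2.
  by rewrite mulr_ge0 ?sqr_ge0 ?divr_ge0// ltW.
have ne : 0 <= n * eta * enorm (grad f x1) by rewrite !mulr_ge0 ?enorm_ge0// ltW.
have q0 : 0 <= q.
  apply: addr_ge0; last by rewrite mulr_ge0// ltW.
  exact: mulr_ge0 (ltW X0) (addr_ge0 (addr_ge0 D0 ne) Le).
apply: (@le_trans _ _ (\sum_(1 <= k < t.+1) q)).
  rewrite big_nat [leRHS]big_nat; apply: ler_sum => k /andP[k1 kt].
  have kT : (1 <= k <= T)%N by rewrite k1 (leq_trans _ tT).
  apply: le_trans (stoch_grad_sqr_le kT) _.
  have := ler_wpM2l (ltW X0) (gap_growth kT); rewrite -/n -/Delta1 /q /X /noise_level.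
  have := ler_wpM2l (ltW B_gt0) (grad_sqr_le_gap k); have := grad_sqr_le_gap k.
  by move=> ? ? ?; lra.
rewrite sumr_const_nat subn1 /= -[q *+ t]mulr_natr.
apply: (@le_trans _ _ (q * n)); first by rewrite ler_wpM2l// ler_nat.
rewrite -subr_ge0 /q.
set e := enorm _ in ne *.
(* The polynomial in [F] exceeds [q * n] term by term: 3 against 1 at [eta * e], 9/2 against 1/2 in
   the cubic term, and one more quadratic term. *)
rewrite [leRHS](_ : _ = 2 * n * (X * (n * eta * e))
  + 9 * X * n * (L / 2 * (n * eta) ^+ 2) - X * n * (L / 2 * (n * eta) ^+ 2)
  + 9 * X * (L / 2 * (n * eta) ^+ 2)); last by field.
have := mulr_ge0 (ltW X0) Le; have := mulr_ge0 n0 (mulr_ge0 (ltW X0) Le).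
have := mulr_ge0 n0 (mulr_ge0 (ltW X0) ne); lra.
Qed.

(** The descent inequality has the gradient at [x t]. Replacing it by the one at [xb t] costs [L]
    times lag times step length, which Young's inequality divides between the last two terms. *)
Lemma one_step t : (1 <= t <= T)%N ->
  f (x t.+1) <= f (x t) - et t * dot (v t) (g t)
    + L / 2 * enorm (xb t - x t) ^+ 2 + L * (et t ^+ 2 * enorm (g t) ^+ 2).
Proof.
move=> tT; have := descent f_smooth (x t) (x t.+1).
have -> : x t.+1 - x t = - (et t *: g t) by rewrite x_step// addrAC subrr add0r.
rewrite dotNr dotZr enormN enormZ.
have e0 := adaptive_step_gt0 t; rewrite gtr0_norm// exprMn.
have := dot_le_enorm (v t - grad f (x t)) (g t); rewrite dotBl.
have := ler_norm (dot (v t) (g t) - dot (grad f (x t)) (g t)).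
have := ler_wpM2r (enorm_ge0 (g t)) (f_smooth.2 (xb t) (x t)).
move: e0; move: (dot _ (g t)) (dot (grad f (x t)) _) (enorm (xb t - x t)) (enorm (g t)).
move: (enorm (v t - _)) (et t) => c e p q a b e0 h1 h2 h3.
have : e * (p - q) <= e * (L * a * b).
  by rewrite ler_pM2l//; lra.
have : 0 <= L * (a - e * b) ^+ 2 by rewrite mulr_ge0 ?sqr_ge0// ltW.
by rewrite !expr2; lra.
Qed.

(** First [et t] is exchanged for [he t], which by [proxy_step_error] takes 1/6 of the gradient
    term; then [g t] is exchanged for [v t], which leaves the martingale term. *)
Lemma step_with_proxy t : (1 <= t <= T)%N ->
  - (et t * dot (v t) (g t)) <= - (5 / 6 * (he t * enorm (v t) ^+ 2))
    + he t * dot (v t) (v t - g t)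
    + 4 * eta * Num.sqrt (nz t) * (enorm (g t) ^+ 2 / S t).
Proof.
move=> /andP[]; case: t => // t _ tT.
have N0 := noise_level_gt0 (xb t.+1).
have vgN : `|enorm (v t.+1) - enorm (g t.+1)| <= Num.sqrt (nz t.+1).
  apply: le_trans (enorm_dist _ _) _; rewrite enormB -(ger0_norm (enorm_ge0 _)).
  by rewrite -sqrtr_sqr ler_wsqrtr// noise.
have := proxy_step_error (gsum_gt0 t) (sqrtr_ge0 (nz t.+1)) (enorm_ge0 _)
  (enorm_ge0 _) vgN (dot_le_enorm _ _).
rewrite (sqr_sqrtr (ltW N0)) -gsumS dotBr -enorm_sqr => h.
have := ler_wpM2l (ltW eta_gt0) h.
rewrite /proxy_step /adaptive_step -/(S t.+1) /=; move: (_ / S t.+1) => q.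
lra.
Qed.

Context (l : R) (l_ge0 : 0 <= l).
Let DeltaL := 4 * Delta1 + 8 * L * eta ^+ 2 * F
    + 36 * eta ^+ 2 * (A + 2 * B * L) * l ^+ 2
    + 12 * eta * Num.sqrt C * l
    + 64 * eta ^+ 2 * (A + 2 * B * L) * F ^+ 2
    + 16 * eta * Num.sqrt C * F
    + 10 * L * eta ^+ 2.
Let M := Num.sqrt ((A + 2 * B * L) * DeltaL + C).

(** Here [l] stands for the logarithm of [T / delta]. Terms with a gap above [DeltaL] are dropped
    one by one, rather than all terms after a stopping time; once the gap is known to stay below
    [DeltaL], both sums are full. *)
Context (martingale : forall t, (1 <= t <= T)%N ->
  \sum_(1 <= k < t.+1 | f (xb k) - fs <= DeltaL)
     he k * dot (v k) (v k - g k) <=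
  3^-1 * \sum_(1 <= k < t.+1 | f (xb k) - fs <= DeltaL)
     he k * enorm (v k) ^+ 2 + 3 * eta * M * l).

Lemma DeltaL_ge : 4 * Delta1 + 10 * L * eta ^+ 2 <= DeltaL.
Proof.
have F0 := F_ge0; have s0 := sqrtr_ge0 C.
have k0 : 0 <= A + 2 * B * L by rewrite addr_ge0 ?mulr_ge0// ltW.
have e0 := ltW eta_gt0.
have := mulr_ge0 (mulr_ge0 (ltW L_gt0) (sqr_ge0 eta)) F0.
have := mulr_ge0 (mulr_ge0 (sqr_ge0 eta) k0) (sqr_ge0 l).
have := mulr_ge0 (mulr_ge0 (sqr_ge0 eta) k0) (sqr_ge0 F).
have := mulr_ge0 (mulr_ge0 e0 s0) l_ge0.
have := mulr_ge0 (mulr_ge0 e0 s0) F0.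
by rewrite /DeltaL; move: (A + 2 * B * L) => k ? ? ? ? ?; lra.
Qed.

Lemma DeltaL_ge0 : 0 <= DeltaL.
Proof.
apply: le_trans DeltaL_ge; have : 0 <= Delta1 := gap_ge0 x1.
by have := mulr_ge0 (ltW L_gt0) (sqr_ge0 eta); lra.
Qed.

Lemma energy t : (t <= T)%N ->
  f (x t.+1) - fs <= Delta1 - \sum_(1 <= k < t.+1) et k * dot (v k) (g k)
    + L / 2 * \sum_(1 <= k < t.+1) enorm (xb k - x k) ^+ 2
    + L * \sum_(1 <= k < t.+1) (et k ^+ 2 * enorm (g k) ^+ 2).
Proof.
elim: t => [|t IH] tT; first by rewrite !big_geq// x_init /Delta1; lra.
rewrite !(big_nat_recr t.+1)//=.
by have := IH (ltnW tT); have := @one_step t.+1 tT; lra.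
Qed.

(** [DeltaL] is chosen for this inequality: each of two AM-GM steps spends a quarter of it, and a
    third quarter less [5 / 2 * L * eta ^+ 2] is exactly the sum of what remains. *)
Lemma M_absorbs : 3 * eta * M * l + 4 * eta * M * F + Delta1
    + 2 * L * eta ^+ 2 * F <= 3 / 4 * DeltaL - 5 / 2 * L * eta ^+ 2.
Proof.
have F0 := F_ge0; have s0 := sqrtr_ge0 C.
have k0 : 0 <= A + 2 * B * L by rewrite addr_ge0 ?mulr_ge0// ltW.
set r := Num.sqrt (A + 2 * B * L); set q := Num.sqrt DeltaL.
(* Subadditivity of the root bounds [M] by an affine function of [q], so that AM-GM can trade [q]
   for [q ^+ 2 = DeltaL]. *)
have ML : M <= r * q + Num.sqrt C.
  have rq : 0 <= r * q by rewrite mulr_ge0 ?sqrtr_ge0.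
  rewrite -(ger0_norm (addr_ge0 rq s0)) -sqrtr_sqr ler_wsqrtr//.
  rewrite sqrrD exprMn !sqr_sqrtr ?DeltaL_ge0 ?(ltW C_gt0)//.
  by have := mulr_ge0 rq s0; lra.
have qE : q ^+ 2 = DeltaL by rewrite sqr_sqrtr ?DeltaL_ge0.
have rE : r ^+ 2 = A + 2 * B * L by rewrite sqr_sqrtr.
have e0 := ltW eta_gt0.
have := sqr_ge0 (q / 2 - 3 * eta * l * r).
have := sqr_ge0 (q / 2 - 4 * eta * F * r).
have := ler_wpM2l (addr_ge0 (mulr_ge0 (mulr_ge0 (ler0n R 3) e0) l_ge0)
  (mulr_ge0 (mulr_ge0 (ler0n R 4) e0) F0)) ML.
have : DeltaL = DeltaL by []; rewrite {1}/DeltaL -rE; move: qE.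
move: (Num.sqrt C) F Delta1 M DeltaL => s' F' D' M' DL.
by rewrite !expr2 => qE dE h1 h2 h3; lra.
Qed.

(** The factor 1/2 is the 5/6 left by the proxy exchange less 1/3 for the martingale. By [lag_sum],
    the lag and step terms together cost at most [2 * L * eta ^+ 2 * F]. *)
Lemma stopped_energy t : (t <= T)%N ->
  (forall k, (1 <= k <= t)%N -> f (xb k) - fs <= DeltaL) ->
  f (x t.+1) - fs + 2^-1 * \sum_(1 <= k < t.+1) he k * enorm (v k) ^+ 2
  <= 3 / 4 * DeltaL - 5 / 2 * L * eta ^+ 2.
Proof.
(* The hypotheses on lag and martingale start at time 1; at time 0 [M_absorbs] suffices, its other
   left-hand terms being nonnegative. *)
case: t => [|t] tT gap_le.
  rewrite big_geq// x_init; have := M_absorbs.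
  have M0 : 0 <= M by rewrite sqrtr_ge0.
  have := mulr_ge0 (mulr_ge0 (ltW eta_gt0) M0) l_ge0.
  have := mulr_ge0 (mulr_ge0 (ltW eta_gt0) M0) F_ge0.
  have := mulr_ge0 (mulr_ge0 (ltW L_gt0) (sqr_ge0 eta)) F_ge0.
  by rewrite -/Delta1; lra.
apply: le_trans M_absorbs; have := energy tT; have := @lag_sum t.+1 tT.
have := @martingale t.+1 tT.
have full (a : nat -> R) : \sum_(1 <= k < t.+2 | f (xb k) - fs <= DeltaL) a k
    = \sum_(1 <= k < t.+2) a k.
  rewrite big_nat_cond [RHS]big_nat_cond; apply: eq_bigl => k.
  by rewrite andbT; case: (boolP (1 <= k < t.+2)%N) => //= /gap_le ->.
rewrite !full.
have es : \sum_(1 <= k < t.+2) (et k ^+ 2 * enorm (g k) ^+ 2) <= eta ^+ 2 * F.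
  under eq_bigr do rewrite adaptive_step_sqr.
  by rewrite -mulr_sumr ler_wpM2l ?sqr_ge0// sum_ratio_le_F.
have M0 : 0 <= M by rewrite sqrtr_ge0.
have step : - \sum_(1 <= k < t.+2) et k * dot (v k) (g k) <=
    - (5 / 6 * \sum_(1 <= k < t.+2) he k * enorm (v k) ^+ 2)
    + \sum_(1 <= k < t.+2) he k * dot (v k) (v k - g k)
    + 4 * eta * M * \sum_(1 <= k < t.+2) (enorm (g k) ^+ 2 / S k).
  rewrite -sumrN !mulr_sumr -sumrN -!big_split/= big_nat [leRHS]big_nat.
  apply: ler_sum => k kt; have kT : (1 <= k <= T)%N.
    by case/andP: kt => ->; rewrite ltnS => kt; exact: leq_trans kt tT.
  apply: le_trans (step_with_proxy kT) _; rewrite lerD2l ler_wpM2r//.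
    by rewrite divr_ge0 ?sqr_ge0// ltW// gsum_gt0.
  rewrite ler_wpM2l ?mulr_ge0// ?(ltW eta_gt0)//.
  by rewrite sqrt_noise_level_le// gap_le.
have eM : 0 <= 4 * eta * M by rewrite !mulr_ge0// ltW.
have := ler_wpM2l eM (sum_ratio_le_F tT).
have := ler_wpM2l (ltW L_gt0) es.
move: step es.
move: (\sum_(1 <= k < t.+2) et k * dot (v k) (g k))
  (\sum_(1 <= k < t.+2) he k * enorm (v k) ^+ 2)
  (\sum_(1 <= k < t.+2) (enorm (g k) ^+ 2 / S k))
  (\sum_(1 <= k < t.+2) he k * dot (v k) (v k - g k))
  (\sum_(1 <= k < t.+2) (et k ^+ 2 * enorm (g k) ^+ 2))
  (\sum_(1 <= k < t.+2) enorm (xb k - x k) ^+ 2) => s1 s2 s3 s4 s5 s6.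
move: F Delta1 M => F' D1 M' h1 h2 h3 h4 h5 h6 h7.
have := ler_wpM2l (ltW L_gt0) h6; lra.
Qed.

(** Strong induction, where [stopped_energy] controls the gap at [x t]. Passing to [xb t] costs a
    factor 4/3 and [2 * L * eta ^+ 2]; the 3/4 and the 5/2 there make room for both. *)
Lemma gap_le_DeltaL t : (1 <= t <= T)%N -> f (xb t) - fs <= DeltaL.
Proof.
elim/ltn_ind: t => -[//|t] IH tT.
have := @stopped_energy t (ltnW tT).
have ind k : (1 <= k <= t)%N -> f (xb k) - fs <= DeltaL.
  move=> /andP[k1 kt]; apply: IH; first by rewrite ltnS.
  by rewrite k1 (leq_trans kt (ltnW tT)).
move=> /(_ ind); set s := \sum_(_ <= _ < _) _.
have s0 : 0 <= s.
  apply: sumr_ge0 => k _; rewrite mulr_ge0 ?sqr_ge0// ltW//.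
  exact: proxy_step_gt0.
have := descent f_smooth (x t.+1) (xb t.+1).
have := grad_sqr_le L_gt0 f_smooth (x t.+1) fs_le.
have := dot_le_enorm (grad f (x t.+1)) (xb t.+1 - x t.+1).
have := ler_norm (dot (grad f (x t.+1)) (xb t.+1 - x t.+1)).
have := @lag_le t.+1 tT; have := enorm_ge0 (xb t.+1 - x t.+1).
have := enorm_ge0 (grad f (x t.+1)).
move: (dot _ _) (enorm (grad _ _)) (enorm (_ - _)) => p a b a0 b0 be.
have Lb : L * b ^+ 2 <= L * eta ^+ 2.
  by rewrite ler_pM2l// ler_pXn2r ?nnegrE// ltW.
(* The weight [6 * L] turns the squared gradient into at most a third of the gap; the 3/2 on the lag
   joins the 1/2 of [descent]. *)
have : 0 <= (a - 3 * L * b) ^+ 2 / (6 * L) by rewrite divr_ge0 ?sqr_ge0 ?mulr_ge0// ltW.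
have -> : (a - 3 * L * b) ^+ 2 / (6 * L) =
  a ^+ 2 / (6 * L) - a * b + 3 / 2 * (L * b ^+ 2) by field; rewrite gt_eqF.
move=> h1 h2 h3 h4 h5 h6.
have : a ^+ 2 / (6 * L) <= (f (x t.+1) - fs) / 3.
  rewrite ler_pdivrMr ?mulr_gt0//; lra.
have := mulr_ge0 (ltW L_gt0) (sqr_ge0 eta).
by move: DeltaL h6 => DL h6 h7; lra.
Qed.

(** All proxy steps up to [T] are at least [eta / Num.sqrt W], so [stopped_energy] bounds [s] by a
    multiple of [Num.sqrt W], where [W] is itself affine in [s]. *)
Lemma sum_grad_sqr_le :
  n^-1 * \sum_(1 <= t < T.+1) enorm (v t) ^+ 2 <=
      (3 * DeltaL * G0 / eta
       + 9 * DeltaL ^+ 2 / (2 * eta ^+ 2) * (B + 1)) * n^-1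
      + 3 * DeltaL / (eta * Num.sqrt n) * Num.sqrt (2 * (A * DeltaL + C)).
Proof.
set s := \sum_(_ <= _ < _) _.
have s0 : 0 <= s by apply: sumr_ge0 => k _; rewrite sqr_ge0.
have DL0 := DeltaL_ge0.
have n0 : 0 < n by rewrite ltr0n.
have e0 := ltW eta_gt0; have B0 := ltW B_gt0.
pose a := 2 * (A * DeltaL + C).
have a0 : 0 <= a by rewrite mulr_ge0 ?addr_ge0 ?mulr_ge0// ltW.
pose W := G0 ^+ 2 + n * a + 2 * (B + 1) * s.
have G2 : 0 < G0 ^+ 2 by rewrite exprn_gt0.
have W0 : 0 < W.
  have na := mulr_ge0 (ltW n0) a0.
  have bs := mulr_ge0 (mulr_ge0 (ler0n R 2) (addr_ge0 B0 ler01)) s0.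
  by rewrite /W -addrA ltr_pwDl// addr_ge0.
have heW k : (1 <= k <= T)%N -> eta / Num.sqrt W <= he k.
  move=> kT; rewrite ler_pM2l// lef_pV2 ?posrE ?sqrtr_gt0 ?proxy_arg_gt0//.
  rewrite ler_wsqrtr//; pose u i := a + 2 * (B + 1) * enorm (v i) ^+ 2.
  have u0 i : 0 <= u i by rewrite addr_ge0// mulr_ge0 ?sqr_ge0// mulr_ge0 ?addr_ge0.
  have nzu i : (1 <= i <= T)%N -> 2 * nz i + 2 * enorm (v i) ^+ 2 <= u i.
    move=> iT; have := ler_wpM2l (ltW A_gt0) (gap_le_DeltaL iT).
    by rewrite /noise_level /u /a; move: DeltaL => DL; lra.
  have -> : W = G0 ^+ 2 + \sum_(1 <= i < T.+1) u i.
    rewrite /W /u big_split/= sumr_const_nat subn1/= -mulr_sumr -[a *+ T]mulr_natl.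
    by rewrite addrA.
  have /andP[k1 kTT] := kT.
  (* Split at [k]: the earlier terms dominate the [enorm (g i) ^+ 2], the term at [k] dominates the
     current gradient and noise, and the later ones are nonnegative. *)
  rewrite (@big_cat_nat _ _ _ k) ?(leqW kTT)//= /gsum prednK// -!addrA lerD2l lerD//.
    apply: ler_sum_nat => i /andP[i1 ik].
    have iT : (1 <= i <= T)%N by rewrite i1 (leq_trans (ltnW ik)).
    exact: le_trans (stoch_grad_sqr_le iT) (nzu _ iT).
  rewrite big_ltn ?ltnS// -[leLHS]addr0 lerD ?sumr_ge0//.
  have := nzu _ kT; have := noise_level_gt0 (xb k); have := sqr_ge0 (enorm (v k)).
  by lra.
pose c := 3 / 2 * DeltaL / eta.
have c0 : 0 <= c by rewrite divr_ge0 ?mulr_ge0 ?divr_ge0.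
have sc : s <= c * Num.sqrt W.
  have := @stopped_energy T (leqnn _) gap_le_DeltaL.
  have : eta / Num.sqrt W * s <= \sum_(1 <= k < T.+1) he k * enorm (v k) ^+ 2.
    rewrite /s mulr_sumr big_nat [leRHS]big_nat; apply: ler_sum => k kT.
    by rewrite ler_wpM2r ?sqr_ge0 ?heW.
  have := gap_ge0 (x T.+1); have := mulr_ge0 (ltW L_gt0) (sqr_ge0 eta).
  rewrite [X in _ -> _ -> _ -> _ -> _ <= X](_ : _ = 3 / 2 * DeltaL * Num.sqrt W / eta);
    last by rewrite /c mulrAC.
  rewrite ler_pdivlMr//.
  rewrite (_ : eta / Num.sqrt W * s = s * eta / Num.sqrt W); last by ring.
  move=> h1 h2 h3 h4; have : s * eta / Num.sqrt W <= 3 / 2 * DeltaL.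
    by move: DeltaL h4 => DL h4; lra.
  by rewrite ler_pdivrMr ?sqrtr_gt0.
have WE : Num.sqrt W <=
    G0 + Num.sqrt n * Num.sqrt a + Num.sqrt (2 * (B + 1)) * Num.sqrt s.
  have G00 := ltW G0_gt0.
  have q0 : 0 <= Num.sqrt n * Num.sqrt a by rewrite mulr_ge0 ?sqrtr_ge0.
  have r0 : 0 <= Num.sqrt (2 * (B + 1)) * Num.sqrt s by rewrite mulr_ge0 ?sqrtr_ge0.
  rewrite -(ger0_norm (addr_ge0 (addr_ge0 G00 q0) r0)) -sqrtr_sqr ler_wsqrtr//.
  have qE : (Num.sqrt n * Num.sqrt a) ^+ 2 = n * a.
    by rewrite exprMn !sqr_sqrtr// ltW.
  have rE : (Num.sqrt (2 * (B + 1)) * Num.sqrt s) ^+ 2 = 2 * (B + 1) * s.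
    by rewrite exprMn !sqr_sqrtr// mulr_ge0 ?addr_ge0.
  have := mulr_ge0 G00 q0; have := mulr_ge0 (addr_ge0 G00 q0) r0.
  rewrite /W -qE -rE; move: (_ * _) (Num.sqrt (2 * _) * _) => q r.
  by rewrite !expr2; lra.
rewrite mulrC ler_pdivrMr// mulrDl mulfVK ?gt_eqF//.
have -> : 3 * DeltaL / (eta * Num.sqrt n) * Num.sqrt (2 * (A * DeltaL + C)) * n
    = 2 * c * (Num.sqrt n * Num.sqrt a).
  rewrite -/a -{2}(sqr_sqrtr (ltW n0)) /c.
  by field; rewrite !gt_eqF ?sqrtr_gt0.
have -> : 3 * DeltaL * G0 / eta + 9 * DeltaL ^+ 2 / (2 * eta ^+ 2) * (B + 1)
    = 2 * c * G0 + c ^+ 2 * (2 * (B + 1)).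
  by rewrite /c; field; rewrite gt_eqF.
(* AM-GM absorbs the term linear in [Num.sqrt s] at the price of half of [s], whence the factor 2 in
   [2 * c]. *)
have := ler_wpM2l c0 WE; have := sqr_ge0 (c * Num.sqrt (2 * (B + 1)) - Num.sqrt s).
have sE := sqr_sqrtr s0; have bE : Num.sqrt (2 * (B + 1)) ^+ 2 = 2 * (B + 1).
  by rewrite sqr_sqrtr// mulr_ge0 ?addr_ge0.
move: sE sc bE.
move: (Num.sqrt (2 * (B + 1))) (Num.sqrt s) (Num.sqrt W) (Num.sqrt n * Num.sqrt a).
by move=> b r w q sE sc <-; clearbody c W s; move: sE sc; rewrite !expr2; lra.
Qed.

End Path.

(** * Lag between the iterates and their averages *)

Section Lag.
Context {R : realType} {d : nat} (T : nat) (eta G0 : R).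
Context (h : nat -> 'rV[R]_d -> 'rV[R]_d) (x1 : 'rV[R]_d).
Context (x xt xb g : nat -> 'rV[R]_d).
Context (eta_gt0 : 0 < eta) (G0_gt0 : 0 < G0).
Local Notation et := (adaptive_step eta G0 g).

(** Equal step sizes keep [xt] and [x] equal by induction, so averaging them changes nothing. *)
Lemma adagrad_norm_lag (alpha : nat -> R) t :
  adagrad_norm T eta G0 alpha h x1 x xt xb g ->
  (1 <= t <= T)%N -> xb t = x t.
Proof.
move=> alg; have xtx k : (k <= T)%N -> xt k.+1 = x k.+1.
  elim: k => [|k IH] kT; first by rewrite (agd_xt_init alg) (agd_x_init alg).
  rewrite (agd_xt alg)// (agd_x alg)// (agd_xb alg)// IH ?(ltnW kT)//.
  by rewrite -scalerDl [alpha _ + _]addrC subrK scale1r.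
case: t => // t /andP[_ tT].
by rewrite (agd_xb alg)// xtx ?(ltnW tT)// -scalerDl [alpha _ + _]addrC subrK scale1r.
Qed.

Lemma rsag_alpha_bound t : (0 < t)%N -> 0 <= rsag_alpha R t <= 1.
Proof.
move=> t0; have t1 : 1 <= t%:R :> R by rewrite ler1n.
rewrite /rsag_alpha divr_ge0 ?addr_ge0//= ler_pdivrMr; lra.
Qed.

Lemma enorm_conv (a : R) (u w : 'rV[R]_d) : 0 <= a <= 1 ->
  enorm ((1 - a) *: u - a *: w) <= (1 - a) * enorm u + a * enorm w.
Proof.
move=> /andP[a0 a1]; apply: le_trans (enormD _ _) _.
by rewrite enormN !enormZ !ger0_norm ?subr_ge0.
Qed.

Context (alg : rsag T eta G0 h x1 x xt xb g).
Local Notation D t := (xt t - x t).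
Local Notation al := (rsag_alpha R).

Lemma rsag_lagE t : (1 <= t <= T)%N -> xb t - x t = (1 - al t) *: D t.
Proof.
move=> tT; rewrite (agd_xb alg)// scalerBr addrAC [RHS]addrC; congr (_ + _).
by rewrite scalerBl scale1r opprB.
Qed.

(** The excess of gamma_t over theta_t is [al t * et t], so the recursion has the convex weights
    [1 - al t] and [al t]. *)
Lemma rsag_lagS t : (1 <= t <= T)%N ->
  D t.+1 = (1 - al t) *: D t - al t *: (et t *: g t).
Proof.
move=> tT; rewrite (agd_xt alg)// (agd_x alg)// -rsag_lagE//.
by apply/rowP => i; rewrite !mxE; ring.
Qed.

Lemma rsag_D_le t : (t <= T)%N -> enorm (D t.+1) <= eta.
Proof.
elim: t => [|t IH] tT.
  by rewrite (agd_xt_init alg) (agd_x_init alg) subrr enorm0 ltW.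
rewrite rsag_lagS//; have a01 := rsag_alpha_bound (ltn0Sn t).
apply: le_trans (enorm_conv _ _ a01) _; case/andP: a01 => a0 a1.
rewrite enormZ gtr0_norm ?adaptive_step_gt0//.
have := adaptive_step_le g eta_gt0 G0_gt0 (ltn0Sn t).
have h0 : 0 <= 1 - al t.+1 by rewrite subr_ge0.
have := ler_wpM2l h0 (IH (ltnW tT)) => h1 h2.
by have := ler_wpM2l a0 h2; lra.
Qed.

Lemma rsag_lag_le t : (1 <= t <= T)%N -> enorm (xb t - x t) <= eta.
Proof.
case: t => // t tT; have /andP[a0 a1] := rsag_alpha_bound (ltn0Sn t).
rewrite rsag_lagE// enormZ ger0_norm ?subr_ge0//.
have := @rsag_D_le t (ltnW tT); have := enorm_ge0 (D t.+1) => D0.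
by apply: le_trans; rewrite ler_piMl//; lra.
Qed.

(* The potential [t |D_(t+1)|^2] absorbs the squared lag because
   [1 - alpha_t = (t - 1) / (t + 1)]. *)
Lemma rsag_lag_sum t : (t <= T)%N ->
  \sum_(1 <= k < t.+1) enorm (xb k - x k) ^+ 2 + t%:R * enorm (D t.+1) ^+ 2 <=
  2 * \sum_(1 <= k < t.+1) (et k ^+ 2 * enorm (g k) ^+ 2).
Proof.
elim: t => [|t IH] tT; first by rewrite !big_geq// mul0r addr0 mulr0.
rewrite !(big_nat_recr t.+1)//= rsag_lagE// (@rsag_lagS t.+1)//.
have := IH (ltnW tT); have a01 := rsag_alpha_bound (ltn0Sn t).
have := enorm_conv (D t.+1) (et t.+1 *: g t.+1) a01.
have := enorm_ge0 ((1 - al t.+1) *: D t.+1 - al t.+1 *: (et t.+1 *: g t.+1)).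
case/andP: a01 => a0 a1; rewrite !enormZ !ger0_norm ?subr_ge0//; last first.
  by rewrite ltW// adaptive_step_gt0.
rewrite -exprMn.
set b := et t.+1 * enorm _; set u := enorm (xt _ - _); set w := enorm (_ - _).
set al1 := al _ in a0 a1 *.
have b0 : 0 <= b by rewrite mulr_ge0 ?enorm_ge0// ltW// adaptive_step_gt0.
have u0 : 0 <= u by rewrite enorm_ge0.
move=> w0 wub h1.
have w2 : w ^+ 2 <= (1 - al1) * u ^+ 2 + al1 * b ^+ 2.
  have : w ^+ 2 <= ((1 - al1) * u + al1 * b) ^+ 2.
    rewrite ler_pXn2r ?nnegrE//.
    by rewrite addr_ge0 ?(mulr_ge0 a0 b0)// mulr_ge0 ?subr_ge0.
  have : 0 <= al1 * (1 - al1) * (u - b) ^+ 2.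
    by apply: mulr_ge0 (sqr_ge0 _); rewrite mulr_ge0 ?subr_ge0.
  by rewrite !expr2; lra.
have E2 : ((1 - al1) * u) ^+ 2 <= (1 - al1) * u ^+ 2.
  rewrite exprMn ler_wpM2r ?sqr_ge0// expr2 ler_piMl ?subr_ge0//; lra.
have t0 : 0 <= t%:R :> R by [].
have aE : al1 = 2 / (t%:R + 2) by rewrite /al1 /rsag_alpha -natr1; congr (_ / _); ring.
have tw : (t%:R + 1) * w ^+ 2 <= (t%:R + 1) * ((1 - al1) * u ^+ 2 + al1 * b ^+ 2).
  by rewrite ler_wpM2l// addr_ge0.
(* The new potential has weight [t + 1] and the squared lag adds 1; [c1] returns the old weight [t],
   and [c2] gives the factor 2 of the claim. *)
have c1 : (t%:R + 2) * (1 - al1) = t%:R.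
  by rewrite aE; field; rewrite gt_eqF// ltr_wpDl.
have c2 : (t%:R + 1) * al1 <= 2.
  by rewrite aE mulrA ler_pdivrMr ?ltr_wpDl//; lra.
have := ler_wpM2r (sqr_ge0 b) c2; have := congr1 (fun r => r * u ^+ 2) c1 => /= c3 c4.
by rewrite -[t.+1%:R]natr1; lra.
Qed.

End Lag.

(** * Measurability of row vectors *)

Section BorelRow.
Context {R : realType} {d : nat}.

(** An open set is a countable union of boxes with rational centre and radius [1 / (k + 1)], and the
    preimage of a box is a finite intersection of coordinate conditions. *)
Lemma measurable_row d0 (T : measurableType d0) (X : T -> 'rV[R]_d) :
  (forall i, measurable_fun [set: T] (fun t => X t 0 i)) ->
  measurable_fun [set: T] (X : T -> borel_rV R d).
Proof.
move=> mX.
apply: (@measurability _ _ _ (borel_rV R d) _ X (@open 'rV[R]_d)) => // _ [U oU <-].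
pose box (p : 'rV[rat]_d * nat) : set 'rV[R]_d :=
  [set v | forall i, `|v 0 i - ratr (p.1 0 i)| < p.2.+1%:R^-1].
have mbox p : measurable (X @^-1` box p).
  have -> : X @^-1` box p =
      \bigcap_(i in [set: 'I_d]) [set t | `|X t 0 i - ratr (p.1 0 i)| < p.2.+1%:R^-1].
    by apply/seteqP; split => [t Xt i _|t Xt i]; exact: Xt.
  apply: fin_bigcap_measurable => // i _.
  rewrite -[X in measurable X]setTI.
  apply: (@measurable_fun_ltr _ _ _ setT _ _ _ _ measurableT [set true]) => //.
  by apply: measurableT_comp => //; apply: measurable_funB.
(* Boxes not contained in [U] are replaced by the empty set, so that the union runs over a whole
   countable type. *)
have -> : U = \bigcup_p (if `[< box p `<=` U >] then box p else set0).
  apply/seteqP; split => [v Uv|v [p _]]; last by case: asboolP => // pU /pU.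
  have /nbhs_ballP[e /= e0 eU] := open_nbhs_nbhs (conj oU Uv).
  have [k ke] : exists k : nat, k.+1%:R^-1 < e / 2.
    have := near_infty_natSinv_lt (PosNum (divr_gt0 e0 (ltr0n R 2))).
    by move=> [N _ NE]; exists N; exact: (NE N (leqnn N)).
  have k0 : 0 < k.+1%:R^-1 :> R by rewrite invr_gt0.
  have rat_near i : exists q : rat, `|v 0 i - ratr q| < k.+1%:R^-1 :> R.
    have [|q] := @rat_in_itvoo R (v 0 i - k.+1%:R^-1) (v 0 i + k.+1%:R^-1).
      by rewrite ltrBlDr -addrA ltrDl addr_gt0.
    by rewrite in_itv/= => /andP[q1 q2]; exists q; rewrite ltr_distlC q1.
  have [q qP] := choice rat_near.
  exists (\row_i q i, k) => //=; case: asboolP => [_ i|[]]; first by rewrite mxE.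
  move=> u uq; apply: eU; split => // i j; rewrite (ord1 i) /ball/= => {i}.
  have := uq j; rewrite /= mxE => uj; have vj := qP j.
  apply: le_lt_trans (ler_distD (ratr (q j)) _ _) _; rewrite (distrC (ratr _)).
  by rewrite [e]splitr ltrD// (lt_trans _ ke).
rewrite setTI preimage_bigcup; apply: countable_bigcupT_measurable => // p.
by case: asboolP => // _; rewrite preimage_set0.
Qed.

Lemma continuous_measurable_row (f : 'rV[R]_d -> R) :
  continuous f -> measurable_fun [set: borel_rV R d] f.
Proof.
move=> /continuousP cf; apply: (measurability _ (RGenOpens.measurableE R)).
move=> _ [_ [a [b ->] <-]]; rewrite setTI; apply: sub_sigma_algebra.
by apply: cf; exact: interval_open.
Qed.

(** [d + 1] is a root-free majorant of the square root of [d]; it stays positive for [d = 0], so it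
    can be divided by. *)
Lemma enorm_le_sup (u : 'rV[R]_d) (e : R) : 0 <= e ->
  (forall i, `|u 0 i| <= e) -> enorm u <= (d%:R + 1) * e.
Proof.
move=> e0 ue; have d0 : 0 <= d%:R :> R by [].
have de : 0 <= (d%:R + 1) * e by rewrite mulr_ge0// addr_ge0.
rewrite -(ger0_norm de) -sqrtr_sqr ler_wsqrtr//.
apply: (@le_trans _ _ (\sum_(i < d) e ^+ 2)).
  by apply: ler_sum => i _; rewrite -real_normK ?num_real// ler_pXn2r ?nnegrE.
rewrite sumr_const card_ord -[_ ^+ 2 *+ d]mulr_natl exprMn ler_wpM2r ?sqr_ge0// sqrrD1.
by have := sqr_ge0 (d%:R : R); lra.
Qed.

Lemma continuous_grad (L : R) (f : 'rV[R]_d -> R) i : 0 < L -> smooth L f ->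
  continuous (fun y => grad f y 0 i).
Proof.
move=> L0 [_ fL] y; apply/(@cvgrPdist_le _ _ _ (nbhs y)) => e e0.
have c0 : 0 < L * (d%:R + 1) by rewrite mulr_gt0// ltr_wpDl.
have r0 : 0 < e / (L * (d%:R + 1)) by rewrite divr_gt0.
near=> u.
have [_ yu] : ball y (e / (L * (d%:R + 1))) u by near: u; exact: nbhsx_ballx.
apply: (@le_trans _ _ (enorm (grad f y - grad f u))).
  rewrite -(ger0_norm (enorm_ge0 _)) -ler_sqr ?nnegrE// !real_normK ?num_real//.
  rewrite enorm_sqr /dot (bigD1 i)//= !mxE -expr2 lerDl.
  by apply: sumr_ge0 => j _; rewrite -expr2 sqr_ge0.
apply: le_trans (fL y u) _.
rewrite -ler_pdivlMl//; apply: le_trans (@enorm_le_sup _ _ (ltW r0) _) _.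
  by move=> j; rewrite !mxE ltW//; exact: yu.
rewrite le_eqVlt; apply/orP; left; apply/eqP; field.
by rewrite !gt_eqF//= ltr_wpDl.
Unshelve. all: by end_near. Qed.

End BorelRow.

(** * Integrating out the next sample *)

Section Past.
Context {dO dZ : measure_display}
  {Omega : measurableType dO} {Z : measurableType dZ} {R : realType}.
Context {P : probability Omega R} {D : probability Z R}.
Context (T : nat) (z : nat -> {RV P >-> Z}) (z_iid : iid_samples D T z).

(** A pi-system generating the sigma-algebra of the first [t] samples. Only the indices 1 to [t] of
    [S] matter; for [t = 0] only the whole space remains. *)
Definition cylinders (t : nat) : set (set Omega) :=
  [set A | exists2 S : nat -> set Z, (forall k, measurable (S k)) &
    A = \bigcap_(k in [set k | (1 <= k <= t)%N]) (z k @^-1` S k)].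

(** Being adapted at time [t] becomes measurability on this copy of [Omega]. *)
Definition past (t : nat) := g_sigma_algebraType (cylinders t).

Lemma cylinders_setI t : setI_closed (cylinders t).
Proof.
move=> _ _ [S mS ->] [S' mS' ->]; exists (fun k => S k `&` S' k).
  by move=> k; exact: measurableI.
by rewrite -bigcapI.
Qed.

Lemma cylindersT t : cylinders t [set: Omega].
Proof.
exists (fun=> [set: Z]) => //; apply/esym/seteqP.
by split=> // w _ k _.
Qed.

Lemma cylinders_le s t : (s <= t)%N -> cylinders s `<=` cylinders t.
Proof.
move=> st _ [S mS ->]; exists (fun k => if (k <= s)%N then S k else setT).
  by move=> k; case: ifP.
apply/seteqP; split => w Sw k /= /andP[k0 ks].
  by case: ifP => // ks'; apply: Sw; rewrite /= k0.
have := Sw k; rewrite /= k0 (leq_trans ks st) => /(_ erefl).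
by rewrite ks.
Qed.

Lemma cylinders_measurable t : cylinders t `<=` measurable.
Proof.
move=> _ [S mS ->]; apply: bigcap_measurableType => k _.
by rewrite -[X in measurable X]setTI; exact: measurable_funP.
Qed.

Lemma past_le_measurable t (A : set Omega) :
  <<s cylinders t >> A -> measurable A.
Proof.
apply: smallest_sub; first exact: sigma_algebra_measurable.
exact: cylinders_measurable.
Qed.

Lemma measurable_past_le s t d' (Y : measurableType d') (h : Omega -> Y) :
  (s <= t)%N -> measurable_fun [set: past s] (h : past s -> Y) ->
  measurable_fun [set: past t] (h : past t -> Y).
Proof.
move=> st mh _ B mB; have := mh measurableT B mB.
by rewrite !setTI; apply: sub_sigma_algebra2; exact: cylinders_le.
Qed.

Lemma measurable_past t d' (Y : measurableType d') (h : Omega -> Y) :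
  measurable_fun [set: past t] (h : past t -> Y) ->
  measurable_fun [set: Omega] h.
Proof.
move=> mh _ B mB; have := mh measurableT B mB.
by rewrite !setTI; exact: past_le_measurable.
Qed.

Lemma measurable_sample_past t : (0 < t)%N ->
  measurable_fun [set: past t] (z t : past t -> Z).
Proof.
move=> t0 _ B mB; rewrite setTI; apply: sub_sigma_algebra.
exists (fun k => if k == t then B else setT); first by move=> k; case: ifP.
apply/seteqP; split => w Bw; last by have := Bw t; rewrite /= t0 leqnn eqxx; exact.
by move=> k _ /=; case: eqP => // ->.
Qed.

Lemma sample_law t B : (1 <= t <= T)%N -> measurable B ->
  P (z t @^-1` B) = D B.
Proof. by move=> tT mB; exact: z_iid.2. Qed.

Lemma cylinder_indep t A B : (t < T)%N -> cylinders t A -> measurable B ->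
  P (A `&` z t.+1 @^-1` B) = (P A * D B)%E.
Proof.
move=> tT [S mS ->] mB.
have [indep _] := z_iid.
(* Ordinals are one behind the samples: [i] is sample [i + 1], so [J] holds the samples 1 to [t] and
   [J'] adds sample [t + 1]. *)
pose S' (i : 'I_T) := if (i < t)%N then S i.+1 else B.
have mS' (i : 'I_T) : measurable (S' i) by rewrite /S'; case: ifP.
pose J := [set i : 'I_T | (i < t)%N]%SET; pose J' := (Ordinal tT |: J)%SET.
have capJ : \bigcap_(k in [set k | (1 <= k <= t)%N]) (z k @^-1` S k) =
    \bigcap_(i in [set` J]) (z (nat_of_ord i).+1 @^-1` S' i).
  apply/seteqP; split => w Sw.
    move=> i; rewrite /= /S' inE => it; rewrite it.
    by apply: (Sw i.+1); rewrite /= it.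
  move=> [//|k] /= kt; have kT : (k < T)%N by exact: ltn_trans kt tT.
  by have := Sw (Ordinal kT); rewrite /= /S' inE /= kt; exact.
have capJ' : \bigcap_(k in [set k | (1 <= k <= t)%N]) (z k @^-1` S k)
    `&` z t.+1 @^-1` B = \bigcap_(i in [set` J']) (z (nat_of_ord i).+1 @^-1` S' i).
  rewrite capJ; apply/seteqP; split => w.
    move=> [Sw Bw] i; rewrite /= !inE => /orP[/eqP ->|it].
      by rewrite /S' /= ltnn.
    by apply: Sw; rewrite /= inE.
  move=> Sw; split; first by move=> i /= iJ; apply: Sw; rewrite /= inE iJ orbT.
  by have := Sw (Ordinal tT); rewrite /= /S' /= ltnn !inE eqxx; exact.
rewrite capJ' (indep J' S')// capJ (indep J S')// big_setU1/=; last first.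
  by rewrite inE /= ltnn.
by rewrite /S' /= ltnn muleC sample_law.
Qed.

(** Both sides are finite measures in [A] that agree on the cylinders, a pi-system containing the
    whole space, hence on the sigma-algebra it generates. *)
Lemma past_indep t A B : (t < T)%N -> <<s cylinders t >> A -> measurable B ->
  P (A `&` z t.+1 @^-1` B) = (P A * D B)%E.
Proof.
move=> tT At mB.
have mzB : measurable (z t.+1 @^-1` B).
  by rewrite -[X in measurable X]setTI; exact: measurable_funP.
have DB0 : 0 <= fine (D B) by exact: fine_ge0.
have scaleE C : (P C * D B)%E = mscale (NngNum DB0) P C.
  by rewrite /mscale /= fineK ?fin_num_measure// muleC.
rewrite scaleE -[LHS]/(mrestr P mzB A).
apply: (@g_sigma_algebra_measure_unique _ R _ (cylinders t)
  (@cylinders_measurable t) (fun=> setT)) At => //.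
- by move=> _; exact: cylindersT.
- by rewrite bigcup_const//; exists 0%N.
- exact: cylinders_setI.
- by move=> C Ct; exact: etrans (cylinder_indep tT Ct mB) (scaleE C).
- move=> _; rewrite /mrestr (le_lt_trans (probability_le1 _ _)) ?ltry//.
  exact: measurableI.
Qed.

Lemma measurable_past_id t : measurable_fun [set: Omega] (id : Omega -> past t).
Proof. by move=> _ A mA; rewrite setTI; exact: past_le_measurable mA. Qed.

Lemma measurable_past_sample t : measurable_fun [set: Omega]
  (fun w => (w, z t.+1 w) : past t * Z).
Proof.
by apply: measurable_fun_pair; [exact: measurable_past_id|exact: measurable_funP].
Qed.

(** This takes the place of conditional expectation: by [past_indep] the joint law of past and next
    sample is a product, and Tonelli integrates the sample first, with the past frozen. *)
Lemma past_integral_le t (Psi : past t * Z -> \bar R) (phi : past t -> \bar R) :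
  (t < T)%N -> measurable_fun [set: past t * Z] Psi ->
  (forall p, (0 <= Psi p)%E) ->
  measurable_fun [set: past t] phi -> (forall w, (0 <= phi w)%E) ->
  (forall w : past t, (\int[D]_y Psi (w, y) <= phi w)%E) ->
  (\int[P]_w Psi (w, z t.+1 w) <= \int[P]_w phi w)%E.
Proof.
move=> tT mPsi Psi0 mphi phi0 le_phi.
pose idm : {mfun Omega >-> past t} := mfun_Sub (mem_set (@measurable_past_id t)).
pose prm : {mfun Omega >-> (past t * Z)%type} :=
  mfun_Sub (mem_set (@measurable_past_sample t)).
pose m1 := distribution P idm.
have lawE X : measurable X -> (m1 \x D)%E X = distribution P prm X.
  apply: product_measure_unique => A B mA mB.
  rewrite /m1 /distribution /pushforward /=; exact: past_indep.
have -> : (\int[P]_w Psi (w, z t.+1 w) = \int[m1 \x D]_p Psi p)%E.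
  rewrite (@eq_measure_integral _ _ _ _ (distribution P prm)); last first.
    by move=> X mX _; exact: lawE.
  by rewrite ge0_integral_distribution.
rewrite fubini_tonelli1//.
have -> : (\int[P]_w phi w = \int[m1]_w phi w)%E.
  by rewrite ge0_integral_distribution.
apply: ge0_le_integral => //.
- by move=> w _; exact: integral_ge0.
- exact: measurable_fun_fubini_tonelli_F.
- by move=> w _; exact: le_phi.
Qed.

End Past.

(** * Exponential moments *)

Section Mean.
Context {dZ : measure_display} {Z : measurableType dZ} {R : realType}.
Context {D : probability Z R}.
Implicit Types X Y : Z -> R.

Lemma has_mean_cst (c : R) : has_mean D (cst c) c.
Proof.
split; last exact: expectation_cst.
exact: finite_measure_integrable_cst.
Qed.

Lemma has_meanZ (k : R) X m : has_mean D X m ->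
  has_mean D (fun y => k * X y) (k * m).
Proof.
move=> [iX eX]; split; first exact: (integrableZl measurableT k iX).
have -> : (fun y => k * X y) = (k \o* X) by apply/funext => y; rewrite /= mulrC.
by rewrite expectationZl ?eX ?EFinM//; exact/Lfun1_integrable.
Qed.

Lemma has_meanD X Y m m' : has_mean D X m -> has_mean D Y m' ->
  has_mean D (fun y => X y + Y y) (m + m').
Proof.
move=> [iX eX] [iY eY]; split; first exact: (integrableD measurableT iX iY).
have -> : (fun y => X y + Y y) = (X \+ Y)%R by [].
by rewrite expectationD ?eX ?eY//; exact/Lfun1_integrable.
Qed.

Lemma has_mean_sum (I : Type) (s : seq I) (X : I -> Z -> R) (m : I -> R) :
  (forall i, has_mean D (X i) (m i)) ->
  has_mean D (fun y => \sum_(i <- s) X i y) (\sum_(i <- s) m i).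
Proof.
move=> hX; elim: s => [|i s IH].
  rewrite big_nil; under eq_fun do rewrite big_nil; exact: has_mean_cst.
by rewrite big_cons; under eq_fun do rewrite big_cons; exact: has_meanD.
Qed.

(** The square of [expR (y / 2) <= 1 / (1 - y / 2)], which follows from the tangent bound at
    [- (y / 2)]. *)
Lemma expR_le_quadratic (y : R) : `|y| <= 3^-1 -> expR y <= 1 + y + y ^+ 2.
Proof.
rewrite ler_norml => /andP[y1 y2].
have h : (1 - y / 2) <= expR (- (y / 2)) by exact: expR_ge1Dx.
have h0 : 0 < 1 - y / 2 by lra.
have -> : y = y / 2 + y / 2 by field.
rewrite expRD; have := expRxMexpNx_1 (y / 2); have := expR_gt0 (y / 2).
have -> : y / 2 + y / 2 = y by field.
move: (expR (y / 2)) (expR (- (y / 2))) h => a b h a0 ab.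
have ah : a * (1 - y / 2) <= 1 by have := ler_wpM2l (ltW a0) h; rewrite ab.
have a2 : a * a * (1 - y / 2) ^+ 2 <= 1.
  rewrite -[leRHS](expr1n _ 2) (_ : a * a * _ = (a * (1 - y / 2)) ^+ 2); last by ring.
  by rewrite ler_pXn2r ?nnegrE// mulr_ge0// ltW.
have h2 : 0 < (1 - y / 2) ^+ 2 by rewrite exprn_gt0.
rewrite -(ler_pM2r h2); apply: le_trans a2 _.
(* A quarter of this is [(1 + y + y ^+ 2) * (1 - y / 2) ^+ 2 - 1]; the sign comes from
   [y <= 3^-1]. *)
have : 0 <= y ^+ 2 * (1 - 3 * y + y ^+ 2).
  by rewrite mulr_ge0 ?sqr_ge0//; have := sqr_ge0 y; lra.
by rewrite !expr2; lra.
Qed.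

(** By the quadratic bound the mean of the exponential of [Y] is at most [1 + V], hence at most
    [expR V]. *)
Lemma expR_moment_le (Y : Z -> R) (V : R) : has_mean D Y 0 ->
  {ae D, forall y, `|Y y| <= 3^-1 /\ Y y ^+ 2 <= V} ->
  (\int[D]_y (expR (Y y - V))%:E <= 1)%E.
Proof.
move=> mY aeY; have [/measurable_int/measurable_EFinP mY' _] := mY.
have [iW eW] : has_mean D (fun y => expR (- V) * (1 + V + Y y))
    (expR (- V) * (1 + V + 0)).
  by apply: has_meanZ; apply: has_meanD => //; exact: has_mean_cst.
have le1 : expR (- V) * (1 + V + 0) <= 1.
  have := ler_wpM2l (expR_ge0 (- V)) (expR_ge1Dx V).
  by rewrite addr0 -expRD addNr expR0.
set W := fun y => _ in iW eW.
have mW : measurable_fun [set: Z] (EFin \o W) by exact: measurable_int iW.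
have aeW : {ae D, forall y, expR (Y y - V) <= W y}.
  apply: filterS aeY => y [Y1 Y2]; rewrite /W expRD mulrC ler_wpM2l ?expR_ge0//.
  by apply: le_trans (expR_le_quadratic Y1) _; lra.
apply: (@le_trans _ _ (\int[D]_y (EFin \o W) y)%E); last first.
  rewrite -[leLHS]/(\int[D]_y (W y)%:E)%E.
  by move: eW; rewrite unlock => ->; rewrite lee_fin.
(* [W] is known to be nonnegative only almost everywhere; its absolute value allows a comparison of
   integrals of nonnegative functions. *)
rewrite -(@ae_eq_integral _ _ _ D setT (EFin \o W) (fun y => `|(W y)%:E|)%E)//.
- apply: ae_ge0_le_integral => //.
  + apply/measurable_EFinP; apply: measurableT_comp => //.
    by apply: measurable_funB.
  + exact: measurableT_comp.
  + apply: filterS aeW => y h _; rewrite lee_fin; apply: le_trans h _.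
    exact: ler_norm.
- exact: measurableT_comp.
- apply: filterS aeW => y h _; rewrite /= ger0_norm//.
  exact: le_trans (expR_ge0 _) h.
Qed.

End Mean.

(** * Measurability of the iterates *)

Section RowFunctions.
Context {d0 : measure_display} {T0 : measurableType d0} {R : realType} {d : nat}.
Implicit Types (h k : T0 -> 'rV[R]_d) (a : T0 -> R).

Definition row_measurable h :=
  forall i, measurable_fun [set: T0] (fun w => h w 0 i).

Lemma row_measurableD h k : row_measurable h -> row_measurable k ->
  row_measurable (fun w => h w + k w).
Proof.
move=> mh mk i; under eq_fun do rewrite mxE; exact: measurable_funD.
Qed.

Lemma row_measurableZ a h : measurable_fun [set: T0] a -> row_measurable h ->
  row_measurable (fun w => a w *: h w).
Proof.
move=> ma mh i; under eq_fun do rewrite mxE; exact: measurable_funM.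
Qed.

Lemma row_measurableB h k : row_measurable h -> row_measurable k ->
  row_measurable (fun w => h w - k w).
Proof.
move=> mh mk i; under eq_fun do rewrite !mxE; exact: measurable_funB.
Qed.

Lemma measurable_dot h k : row_measurable h -> row_measurable k ->
  measurable_fun [set: T0] (fun w => dot (h w) (k w)).
Proof. by move=> mh mk; apply: measurable_sum => i; exact: measurable_funM. Qed.

Lemma measurable_enorm_sqr h : row_measurable h ->
  measurable_fun [set: T0] (fun w => enorm (h w) ^+ 2).
Proof.
move=> mh; under eq_fun do rewrite enorm_sqr; exact: measurable_dot.
Qed.

Lemma measurable_div_sqrt (eta : R) a : (forall w, 0 <= a w) ->
  measurable_fun [set: T0] a ->
  measurable_fun [set: T0] (fun w => eta / Num.sqrt (a w)).
Proof.
move=> a0 ma; have -> : (fun w => eta / Num.sqrt (a w)) =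
    (fun w => eta * (a w) `^ (- 2^-1)).
  by apply/funext => w; rewrite powRN powR12_sqrt.
apply: measurable_funM => //.
exact: (@measurableT_comp _ _ _ _ _ _ (fun r : R => r `^ (- 2^-1)) _ a
  (measurable_powR _) ma).
Qed.

End RowFunctions.

Section Iterates.
Context {dO dZ : measure_display}
  {Omega : measurableType dO} {Z : measurableType dZ} {R : realType} {d : nat}.
Context {P : probability Omega R} (T : nat) (z : nat -> {RV P >-> Z}).
Context (G : 'rV[R]_d -> Z -> 'rV[R]_d).
Context (mG : forall i : 'I_d, measurable_fun [set: borel_rV R d * Z]
     (fun p : borel_rV R d * Z => G p.1 p.2 0 i)).
(** [c t] is the ratio of gamma_t to theta_t, 1 for AdaGrad-Norm and [1 + rsag_alpha R t] for RSAG,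
    so that one argument covers both. *)
Context (eta G0 : R) (G0_gt0 : 0 < G0) (alpha c : nat -> R) (x1 : 'rV[R]_d).
Context (x xt xb g : nat -> Omega -> 'rV[R]_d).
Context (alg : forall w, agd T alpha (adaptive_step eta G0 (g ^~ w))
  (fun t => c t * adaptive_step eta G0 (g ^~ w) t)
  (fun t y => G y (z t w)) x1 (x ^~ w) (xt ^~ w) (xb ^~ w) (g ^~ w)).

Local Notation past t := (past z t).

Lemma oracle_measurable d0 (T0 : measurableType d0) (y : T0 -> 'rV[R]_d)
    (s : T0 -> Z) : row_measurable y -> measurable_fun [set: T0] s ->
  row_measurable (fun w => G (y w) (s w)).
Proof.
move=> my ms i.
apply: (measurableT_comp (mG i) (g := fun w => (y w : borel_rV R d, s w))).
by apply: measurable_fun_pair => //; exact: measurable_row.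
Qed.

Lemma row_measurable_past_le s t (h : Omega -> 'rV[R]_d) : (s <= t)%N ->
  row_measurable (h : past s -> 'rV[R]_d) -> row_measurable (h : past t -> 'rV[R]_d).
Proof. by move=> st mh i; exact: measurable_past_le st (mh i). Qed.

Lemma avg_measurable t : (t < T)%N ->
  row_measurable (x t.+1 : past t -> _) -> row_measurable (xt t.+1 : past t -> _) ->
  row_measurable (xb t.+1 : past t -> _).
Proof.
move=> tT mx mxt.
have -> : xb t.+1 = (fun w => alpha t.+1 *: x t.+1 w + (1 - alpha t.+1) *: xt t.+1 w).
  by apply/funext => w; rewrite (agd_xb (alg w)).
by apply: row_measurableD; apply: row_measurableZ.
Qed.

Lemma sample_grad_measurable t : (t < T)%N ->
  row_measurable (xb t.+1 : past t -> _) -> row_measurable (g t.+1 : past t.+1 -> _).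
Proof.
move=> tT mxb.
have -> : g t.+1 = (fun w => G (xb t.+1 w) (z t.+1 w)).
  by apply/funext => w; rewrite (agd_g (alg w)).
apply: (@oracle_measurable _ (past t.+1)); last exact: measurable_sample_past.
exact: row_measurable_past_le mxb.
Qed.

(** The iterates of index [t + 1] use the first [t] samples, whereas [g t.+1] also uses sample
    [t + 1]. The induction passes through the average, the stochastic gradient and the sum, so the
    three facts advance together. *)
Lemma iterates_measurable t : (t <= T)%N ->
  [/\ row_measurable (x t.+1 : past t -> _),
      row_measurable (xt t.+1 : past t -> _) &
      measurable_fun [set: past t] (fun w : past t => gsum G0 (g ^~ w) t)].
Proof.
elim: t => [|t IH] tT.
  have -> : x 1%N = cst x1 by apply/funext => w; rewrite (agd_x_init (alg w)).
  have -> : xt 1%N = cst x1 by apply/funext => w; rewrite (agd_xt_init (alg w)).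
  split => //; under eq_fun do rewrite /gsum big_geq//; exact: measurable_cst.
have [mx mxt mS] := IH (ltnW tT).
have mxb := avg_measurable tT mx mxt.
have mg := sample_grad_measurable tT mxb.
have mS' : measurable_fun [set: past t.+1]
    (fun w : past t.+1 => gsum G0 (g ^~ w) t.+1).
  under eq_fun do rewrite gsumS.
  apply: measurable_funD; last exact: measurable_enorm_sqr.
  exact: measurable_past_le (leqnSn t) mS.
have met : measurable_fun [set: past t.+1]
    (fun w : past t.+1 => adaptive_step eta G0 (g ^~ w) t.+1).
  by apply: measurable_div_sqrt => // w; rewrite ltW// gsum_gt0.
split => //.
- have -> : x t.+2 = (fun w => x t.+1 w
      - adaptive_step eta G0 (g ^~ w) t.+1 *: g t.+1 w).
    by apply/funext => w; rewrite (agd_x (alg w)).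
  apply: row_measurableB; first exact: row_measurable_past_le mx.
  exact: row_measurableZ.
- have -> : xt t.+2 = (fun w => xb t.+1 w
      - (c t.+1 * adaptive_step eta G0 (g ^~ w) t.+1) *: g t.+1 w).
    by apply/funext => w; rewrite (agd_xt (alg w)).
  apply: row_measurableB; first exact: row_measurable_past_le mxb.
  by apply: row_measurableZ => //; exact: measurable_funM.
Qed.

Lemma xb_measurable t : (t < T)%N -> row_measurable (xb t.+1 : past t -> _).
Proof.
by move=> tT; have [mx mxt _] := iterates_measurable (ltnW tT); exact: avg_measurable.
Qed.

Lemma g_measurable t : (t < T)%N -> row_measurable (g t.+1 : past t.+1 -> _).
Proof. by move=> tT; apply: sample_grad_measurable => //; exact: xb_measurable. Qed.

Lemma gsum_measurable t : (t <= T)%N ->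
  measurable_fun [set: past t] (fun w : past t => gsum G0 (g ^~ w) t).
Proof. by move=> /iterates_measurable[]. Qed.

End Iterates.

(** * The stopped exponential supermartingale *)

Section Supermartingale.
Context {dO dZ : measure_display}
  {Omega : measurableType dO} {Z : measurableType dZ} {R : realType} {d : nat}.
Context {P : probability Omega R} {D : probability Z R}.
Context (T : nat) (z : nat -> {RV P >-> Z}) (z_iid : iid_samples D T z).
Context (f : 'rV[R]_d -> R) (G : 'rV[R]_d -> Z -> 'rV[R]_d).
Context (mG : forall i : 'I_d, measurable_fun [set: borel_rV R d * Z]
     (fun p : borel_rV R d * Z => G p.1 p.2 0 i)).
Context (L : R) (L_gt0 : 0 < L) (f_smooth : smooth L f).
Context (f_lb : has_lbound (range f)) (f_unbiased : unbiased D f G).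
Context (A B C : R) (A_gt0 : 0 < A) (B_gt0 : 0 < B) (C_gt0 : 0 < C).
Context (f_noise : affine_noise D f G A B C).
Context (eta G0 : R) (eta_gt0 : 0 < eta) (G0_gt0 : 0 < G0).
Context (alpha c : nat -> R) (x1 : 'rV[R]_d).
Context (x xt xb g : nat -> Omega -> 'rV[R]_d).
Context (alg : forall w, agd T alpha (adaptive_step eta G0 (g ^~ w))
  (fun t => c t * adaptive_step eta G0 (g ^~ w) t)
  (fun t y => G y (z t w)) x1 (x ^~ w) (xt ^~ w) (xb ^~ w) (g ^~ w)).

Local Notation fs := (inf (range f)).
Local Notation nz := (noise_level f fs A B C).

Lemma inf_le y : fs <= f y.
Proof. by apply: ge_inf => //; exists y. Qed.

Context (DL M : R) (M_gt0 : 0 < M).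
Context (nzM : forall y, f y - fs <= DL -> Num.sqrt (nz y) <= M).

Let lam := (3 * eta * M)^-1.

Definition stopped_step (S : R) (y : 'rV[R]_d) : R :=
  if f y - fs <= DL then proxy_step f fs A B C eta S y else 0.

Definition log_increment (S : R) (y : 'rV[R]_d) (s : Z) : R :=
  lam * stopped_step S y * dot (grad f y) (grad f y - G y s)
  - lam / 3 * stopped_step S y * enorm (grad f y) ^+ 2.

Lemma has_mean_error y (k : R) :
  has_mean D (fun s => k * dot (grad f y) (grad f y - G y s)) 0.
Proof.
have -> : 0 = k * \sum_(i < d) grad f y 0 i * (grad f y 0 i + -1 * grad f y 0 i).
  by rewrite big1 ?mulr0// => i _; rewrite mulN1r subrr mulr0.
have -> : (fun s => k * dot (grad f y) (grad f y - G y s)) =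
    (fun s => k * \sum_(i < d) grad f y 0 i * (grad f y 0 i + -1 * G y s 0 i)).
  by apply/funext => s; congr (_ * _); apply: eq_bigr => i _; rewrite !mxE mulN1r.
apply/has_meanZ/has_mean_sum => i; apply/has_meanZ/has_meanD.
  exact: has_mean_cst.
exact: has_meanZ.
Qed.

(** Let [b] be the root in the proxy: it dominates the gradient norm [v] and the noise [N], and
    [N <= M]. As [lam * eta * M] is 1/3, [v * N <= b * M] bounds the increment by 1/3, and
    [N ^+ 2 <= M * b] puts its square below the compensator. *)
Lemma log_increment_moment S y : 0 < S ->
  (\int[D]_s (expR (log_increment S y s))%:E <= 1)%E.
Proof.
move=> S0; apply: expR_moment_le; first exact: has_mean_error.
apply: filterS (f_noise y) => s; rewrite -/(nz y) enormB => noise.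
have lam0 : 0 < lam by rewrite invr_gt0 !mulr_gt0.
rewrite /stopped_step; case: ifPn => [gap|_]; last first.
  by rewrite !(mulr0, mul0r) normr0 expr0n/=.
have n0 : 0 < nz y.
  rewrite /noise_level ltr_wpDl// addr_ge0 ?mulr_ge0 ?enorm_ge0//;
    by rewrite ?subr_ge0 ?inf_le// ltW.
have := nzM gap; rewrite /proxy_step.
have := dot_le_enorm (grad f y) (grad f y - G y s).
have := enorm_ge0 (grad f y - G y s); have := enorm_ge0 (grad f y).
move: (dot _ _) (enorm (grad f y)) (enorm (_ - _)) noise => p v e noise v0 e0 pve.
have := sqr_sqrtr (ltW n0); have := sqrtr_ge0 (nz y).
have arg0 : 0 < S + v ^+ 2 + nz y by rewrite addr_gt0// ltr_pwDl// sqr_ge0.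
have b0 : 0 < Num.sqrt (S + v ^+ 2 + nz y) by rewrite sqrtr_gt0.
have b2 := sqr_sqrtr (ltW arg0).
move: (Num.sqrt (nz y)) (Num.sqrt (S + v ^+ 2 + nz y)) b0 b2 => N b b0 b2 N0 NE NM.
rewrite -NE in noise b2.
have eN : e <= N by rewrite -(@ler_pXn2r _ 2)// nnegrE.
have vb : v <= b.
  by rewrite -(@ler_pXn2r _ 2) ?nnegrE// ?ltW// b2; have := sqr_ge0 N; lra.
have Nb : N <= b.
  by rewrite -(@ler_pXn2r _ 2) ?nnegrE// ?ltW// b2; have := sqr_ge0 v; lra.
have p_le : `|p| <= v * N by apply: le_trans pve _; rewrite ler_wpM2l.
have e0' := ltW eta_gt0; have b0' := ltW b0; have l0 := ltW lam0.
have lamE : lam * eta * M = 3^-1.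
  by rewrite /lam; field; rewrite !gt_eqF.
have bi : 0 < b^-1 by rewrite invr_gt0.
split.
  rewrite normrM gtr0_norm ?mulr_gt0 ?divr_gt0//.
  rewrite -lamE.
  rewrite -!mulrA ler_pM2l// ler_pM2l// -ler_pdivlMl ?invr_gt0// invrK.
  by apply: le_trans p_le _; rewrite ler_pM.
have p2 : p ^+ 2 <= v ^+ 2 * N ^+ 2.
  by rewrite -exprMn -real_normK ?num_real// ler_pXn2r ?nnegrE ?mulr_ge0.
have -> : (lam * (eta / b) * p) ^+ 2 = (lam * eta / b) * lam * eta * (p ^+ 2 / b).
  by field; rewrite gt_eqF.
have -> : lam / 3 * (eta / b) * v ^+ 2 = (lam * eta / b) * lam * eta * (v ^+ 2 * M).
  by rewrite -lamE; field; rewrite gt_eqF.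
apply: ler_wpM2l.
  exact: mulr_ge0 (mulr_ge0 (mulr_ge0 (mulr_ge0 l0 e0') (ltW bi)) l0) e0'.
rewrite ler_pdivrMr//.
apply: le_trans p2 _; rewrite -[leRHS]mulrA ler_wpM2l ?sqr_ge0//.
by rewrite expr2 ler_pM.
Qed.

Definition log_process (t : nat) (w : Omega) : R :=
  \sum_(1 <= k < t.+1) log_increment (gsum G0 (g ^~ w) k.-1) (xb k w) (z k w).

Section Composition.
Context {d0 : measure_display} {T0 : measurableType d0}.
Context (y : T0 -> 'rV[R]_d) (my : row_measurable y).

Lemma objective_measurable : measurable_fun [set: T0] (fun w => f (y w)).
Proof.
apply: (measurableT_comp _ (measurable_row my)).
apply: continuous_measurable_row => v.
exact: (differentiable_continuous (f_smooth.1 v)).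
Qed.

Lemma grad_measurable : row_measurable (fun w => grad f (y w)).
Proof.
move=> i; have mg : measurable_fun [set: borel_rV R d] (fun v => grad f v 0 i).
  by apply: continuous_measurable_row; exact: continuous_grad L_gt0 f_smooth.
exact: (measurableT_comp mg (measurable_row my)).
Qed.

Lemma noise_level_measurable : measurable_fun [set: T0] (fun w => nz (y w)).
Proof.
apply: measurable_funD => //; apply: measurable_funD.
  apply: measurable_funM => //; apply: measurable_funB => //.
  exact: objective_measurable.
by apply: measurable_funM => //; apply: measurable_enorm_sqr; exact: grad_measurable.
Qed.

Lemma log_increment_measurable (S : T0 -> R) (s : T0 -> Z) :
  (forall w, 0 < S w) -> measurable_fun [set: T0] S -> measurable_fun [set: T0] s ->
  measurable_fun [set: T0] (fun w => log_increment (S w) (y w) (s w)).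
Proof.
move=> S0 mS ms; have mgr := grad_measurable.
have mst : measurable_fun [set: T0] (fun w => stopped_step (S w) (y w)).
  apply: measurable_fun_ifT => //.
    apply: measurable_fun_ler => //; apply: measurable_funB => //.
    exact: objective_measurable.
  apply: measurable_div_sqrt.
    by move=> w; rewrite ltW// addr_gt0 ?(noise_level_gt0 inf_le)// ltr_pwDl// sqr_ge0.
  apply: measurable_funD; last exact: noise_level_measurable.
  by apply: measurable_funD => //; exact: measurable_enorm_sqr.
apply: measurable_funB.
  apply: measurable_funM; first exact: measurable_funM.
  apply: measurable_dot => //; apply: row_measurableB => //.
  exact: oracle_measurable.
apply: measurable_funM; first exact: measurable_funM.
exact: measurable_enorm_sqr.
Qed.

End Composition.

Lemma log_process_measurable t : (t <= T)%N ->
  measurable_fun [set: past z t] (log_process t : past z t -> R).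
Proof.
elim: t => [|t IH] tT.
  rewrite /log_process; under eq_fun do rewrite big_geq//; exact: measurable_cst.
rewrite /log_process; under eq_fun do rewrite big_nat_recr//=.
apply: measurable_funD; first exact: measurable_past_le (leqnSn t) (IH (ltnW tT)).
apply: (@log_increment_measurable _ (past z t.+1)).
- exact: row_measurable_past_le (leqnSn t) (xb_measurable mG G0_gt0 alg tT).
- by move=> w; exact: gsum_gt0.
- exact: measurable_past_le (leqnSn t) (gsum_measurable mG G0_gt0 alg (ltnW tT)).
- exact: measurable_sample_past.
Qed.

(** With the past frozen, the accumulated exponential is a constant factor and the next one has mean
    at most 1 by [log_increment_moment]. *)
Lemma log_process_moment t : (t <= T)%N ->
  (\int[P]_w (expR (log_process t w))%:E <= 1)%E.
Proof.
elim: t => [|t IH] tT.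
  under eq_integral do rewrite /log_process big_geq// expR0.
  by rewrite integral_cst//= probability_setT mule1.
apply: le_trans (IH (ltnW tT)).
have -> : (\int[P]_w (expR (log_process t.+1 w))%:E = \int[P]_w
    (expR (log_process t w
      + log_increment (gsum G0 (g ^~ w) t) (xb t.+1 w) (z t.+1 w)))%:E)%E.
  by apply: eq_integral => w _; rewrite /log_process big_nat_recr.
(* [Psi] separates the fresh sample from the point of [Omega] that carries the past. *)
apply: (past_integral_le z_iid (Psi := fun p => (expR (log_process t p.1
     + log_increment (gsum G0 (g ^~ p.1) t) (xb t.+1 p.1) p.2))%:E)
  (phi := fun w => (expR (log_process t w))%:E) tT).
- apply/measurable_EFinP; apply: measurableT_comp => //.
  apply: measurable_funD.
    exact: measurableT_comp (log_process_measurable (ltnW tT)) _.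
  apply: log_increment_measurable => //.
  + by move=> i; exact: measurableT_comp (xb_measurable mG G0_gt0 alg tT i) _.
  + by move=> p; exact: gsum_gt0.
  + exact: measurableT_comp (gsum_measurable mG G0_gt0 alg (ltnW tT)) _.
- by move=> p; rewrite lee_fin expR_ge0.
- apply/measurable_EFinP; apply: measurableT_comp => //.
  exact: log_process_measurable (ltnW tT).
- by move=> w; rewrite lee_fin expR_ge0.
move=> w; under eq_integral do rewrite /= expRD EFinM.
rewrite ge0_integralZl//=.
- rewrite -[leRHS]mule1 lee_wpmul2l ?lee_fin ?expR_ge0//.
  by apply: log_increment_moment; exact: gsum_gt0.
- apply/measurable_EFinP; apply: measurableT_comp => //.
  by apply: log_increment_measurable => // p; exact: gsum_gt0.
Qed.

(** Chernoff's bound at parameter 1, since [lam] is already part of the increments. *)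
Lemma log_process_tail t (l : R) : (t <= T)%N ->
  (P [set w | (l <= log_process t w)%R] <= (expR (- l))%:E)%E.
Proof.
move=> tT.
have mE : measurable_fun [set: Omega] (log_process t : Omega -> R).
  exact: measurable_past (log_process_measurable tT).
pose E : {mfun Omega >-> R} := mfun_Sub (mem_set mE).
apply: le_trans (chernoff (P := P) E l ltr01) _.
rewrite mul1r -[leRHS]mul1e lee_wpmul2r ?lee_fin ?expR_ge0//.
rewrite /mmt_gen_fun unlock; apply: le_trans (log_process_moment tT).
by under eq_integral do rewrite /= mulr1.
Qed.

Definition noise_violation (t : nat) : set Omega :=
  [set w | nz (xb t w) < enorm (g t w - grad f (xb t w)) ^+ 2].

(** The noise assumption provides a null set for each fixed point, while [xb t.+1] is random. As it
    depends on the past only, integrating out the fresh sample first reduces to fixed points. *)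
Lemma noise_violation_null t : (t < T)%N ->
  measurable (noise_violation t.+1) /\ P (noise_violation t.+1) = 0%E.
Proof.
move=> tT; have mxb := xb_measurable mG G0_gt0 alg tT.
have mgr : row_measurable (g t.+1 : Omega -> _).
  by move=> i; exact: measurable_past (g_measurable mG G0_gt0 alg tT i).
have mxb' : row_measurable (xb t.+1 : Omega -> _).
  by move=> i; exact: measurable_past (mxb i).
have mN : measurable (noise_violation t.+1).
  rewrite -[noise_violation _]setTI.
  apply: (@measurable_fun_ltr _ _ _ setT _ _ _ _ measurableT [set true]) => //.
    exact: noise_level_measurable.
  apply: measurable_enorm_sqr; apply: row_measurableB => //; exact: grad_measurable.
split => //; apply/eqP; rewrite eq_le measure_ge0 andbT.
pose V : set (past z t * Z) :=
  [set p | nz (xb t.+1 p.1) < enorm (G (xb t.+1 p.1) p.2 - grad f (xb t.+1 p.1)) ^+ 2].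
have mV : measurable V.
  have mxb1 : row_measurable (fun p : past z t * Z => xb t.+1 p.1).
    by move=> i; exact: measurableT_comp (mxb i) _.
  rewrite -[V]setTI.
  apply: (@measurable_fun_ltr _ _ _ setT _ _ _ _ measurableT [set true]) => //.
    exact: noise_level_measurable.
  apply: measurable_enorm_sqr; apply: row_measurableB; last exact: grad_measurable.
  exact: oracle_measurable.
have := @past_integral_le _ _ _ _ _ P D T z z_iid t
  (fun p => (\1_V p)%:E) (fun=> 0%E) tT _ _ _ _ _.
rewrite integral0.
have -> : (\int[P]_w (\1_V (w, z t.+1 w))%:E = P (noise_violation t.+1))%E.
  have indE w : \1_V (w, z t.+1 w) = \1_(noise_violation t.+1) w :> R.
    rewrite !indicE; congr ((nat_of_bool _)%:R); apply: asbool_equiv_eq.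
    by rewrite /V /noise_violation /= (agd_g (alg w)).
  under eq_integral do rewrite indE.
  by rewrite integral_indic// setIT.
apply => //.
- by apply/measurable_EFinP; exact: measurable_indic.
move=> w; rewrite -(@integral0 _ _ _ D setT); apply: ae_ge0_le_integral => //.
- apply/measurable_EFinP.
  have mI : measurable_fun [set: past z t * Z] (\1_V : _ -> R).
    exact: measurable_indic.
  exact: measurable_fun_pair2 w mI.
apply: filterS (f_noise (xb t.+1 w)) => s; rewrite -/(nz _) => noise _.
rewrite indicE lee_fin; case: (boolP (_ \in V)) => //; rewrite inE /V /=.
by rewrite ltNge noise.
Qed.

(** A union bound over the [T] times: noise violations are null, so each time costs only the tail
    [expR (- l)]. *)
Lemma good_event (l : R) : exists bad : set Omega,
  [/\ measurable bad, (P bad <= (T%:R * expR (- l))%:E)%E &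
      forall w, ~ bad w -> forall t, (1 <= t <= T)%N ->
        enorm (g t w - grad f (xb t w)) ^+ 2 <= nz (xb t w)
        /\ log_process t w <= l].
Proof.
pose F (i : nat) := noise_violation i.+1 `|` [set w | l <= log_process i.+1 w].
have mtail i : (i < T)%N -> measurable [set w | l <= log_process i.+1 w].
  move=> iT; rewrite -[X in measurable X]setTI.
  apply: (@measurable_fun_ler _ _ _ setT _ _ _ _ measurableT [set true]) => //.
  exact: measurable_past (log_process_measurable iT).
have mF i : (i < T)%N -> measurable (F i).
  by move=> iT; apply: measurableU; [exact: (noise_violation_null iT).1|exact: mtail].
exists (\big[setU/set0]_(i < T) F i); split.
- by apply: bigsetU_measurable => i _; exact: mF.
- apply: le_trans (Boole_inequality P mF) _.
  apply: (@le_trans _ _ (\sum_(i < T) (expR (- l))%:E)%E).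
    apply: lee_sum => i _; apply: le_trans (measureU2 _ _ _) _.
    + exact: (noise_violation_null (ltn_ord i)).1.
    + exact: mtail.
    + rewrite -[leRHS]add0e; apply: leeD; last exact: log_process_tail.
      rewrite le_eqVlt; apply/orP; left; apply/eqP.
      exact: (noise_violation_null (ltn_ord i)).2.
  by rewrite sumEFin sumr_const card_ord lee_fin [leRHS]mulr_natl.
move=> w wbad [//|t] /= tT.
have Ft : ~ F t w.
  move=> Fw; apply: wbad; rewrite -bigcup_mkord; by exists t.
split; first by rewrite leNgt; apply/negP => h; apply: Ft; left.
by rewrite leNgt; apply/negP => h; apply: Ft; right; rewrite /= ltW.
Qed.

(** Multiplication by [lam], the inverse of [3 * eta * M], turns the claim into the bound on
    [log_process]; the filter on the sums matches the zero branch of [stopped_step]. *)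
Lemma martingale_le w t (l : R) : (1 <= t <= T)%N -> log_process t w <= l ->
  \sum_(1 <= k < t.+1 | f (xb k w) - fs <= DL)
     proxy_step f fs A B C eta (gsum G0 (g ^~ w) k.-1) (xb k w)
       * dot (grad f (xb k w)) (grad f (xb k w) - g k w) <=
  3^-1 * \sum_(1 <= k < t.+1 | f (xb k w) - fs <= DL)
     proxy_step f fs A B C eta (gsum G0 (g ^~ w) k.-1) (xb k w)
       * enorm (grad f (xb k w)) ^+ 2 + 3 * eta * M * l.
Proof.
move=> /andP[_ tT] El; have lam0 : 0 < lam by rewrite invr_gt0 !mulr_gt0.
have lamV : 3 * eta * M = lam^-1 by rewrite invrK.
rewrite lamV -(ler_pM2l lam0) mulrDr [lam * (lam^-1 * l)]mulrA divff ?gt_eqF// mul1r.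
rewrite -lerBlDl; apply: le_trans El; rewrite /log_process.
rewrite mulrA !mulr_sumr big_mkcond [X in _ - X]big_mkcond -sumrB.
apply: ler_sum_nat => k /andP[k1 kt].
have kT : (1 <= k <= T)%N by rewrite k1 (leq_trans _ tT).
rewrite /log_increment /stopped_step -(agd_g (alg w))//.
by case: ifP => _; rewrite ?(mulr0, mul0r, subr0)// !mulrA.
Qed.

Lemma sum_grad_measurable :
  measurable_fun [set: Omega]
    (fun w => T%:R^-1 * \sum_(1 <= t < T.+1) enorm (grad f (xb t w)) ^+ 2).
Proof.
apply: measurable_funM => //.
under eq_fun do rewrite big_add1 big_mkord.
apply: measurable_sum => i; apply: measurable_enorm_sqr; apply: grad_measurable => j.
exact: measurable_past (xb_measurable mG G0_gt0 alg (ltn_ord i) j).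
Qed.

End Supermartingale.

(** * The pathwise estimate on the good event, for both algorithms *)

Theorem theorem5 (R : realType) (d : nat)
  (dO dZ : measure_display)
  (Omega : measurableType dO) (Z : measurableType dZ)
  (P : probability Omega R) (D : probability Z R)
  (f : 'rV[R]_d -> R) (fz : 'rV[R]_d -> Z -> R)
  (G : 'rV[R]_d -> Z -> 'rV[R]_d)
  (z : nat -> {RV P >-> Z})
  (T : nat) (delta eta G0 L A B C : R)
  (x1 : 'rV[R]_d) (x xt xb g : nat -> Omega -> 'rV[R]_d)
  (hT : (1 <= T)%N)
  (hdelta : 0 < delta < 1)
  (heta : 0 < eta) (hG0 : 0 < G0) (hL : 0 < L)
  (hA : 0 < A) (hB : 0 < B) (hC : 0 < C)
  (hobj : forall y, has_mean D (fz y) (f y))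
  (horacle : gradient_oracle fz G)
  (hz : iid_samples D T z)
  (hsmooth : smooth L f)
  (hinf : has_lbound (range f))
  (hunbiased : unbiased D f G)
  (hnoise : affine_noise D f G A B C)
  (halg :
    (exists alpha : nat -> R,
      (forall t, (1 <= t <= T)%N -> 0 < alpha t <= 1) /\
      (forall w : Omega,
        adagrad_norm T eta G0 alpha (fun t y => G y (z t w)) x1
          (x ^~ w) (xt ^~ w) (xb ^~ w) (g ^~ w)))
    \/
    (forall w : Omega,
      rsag T eta G0 (fun t y => G y (z t w)) x1
        (x ^~ w) (xt ^~ w) (xb ^~ w) (g ^~ w))) :
  let n : R := T%:R in
  let Delta1 := f x1 - inf (range f) in
  let X := 2 * A + 4 * L * B + 4 * L in
  let F := ln (1 +
    ((X * Delta1 + 2 * C) * n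
     + X * (3 * eta * enorm (grad f x1) + 9 * L * eta ^+ 2 / 2) * n ^+ 2
     + 9 * L * eta ^+ 2 / 2 * X * n ^+ 3) / G0 ^+ 2) in
  let DeltaL :=
    4 * Delta1 + 8 * L * eta ^+ 2 * F
    + 36 * eta ^+ 2 * (A + 2 * B * L) * ln (n / delta) ^+ 2
    + 12 * eta * Num.sqrt C * ln (n / delta)
    + 64 * eta ^+ 2 * (A + 2 * B * L) * F ^+ 2
    + 16 * eta * Num.sqrt C * F
    + 10 * L * eta ^+ 2 in
  ((1 - delta)%:E <= P [set w : Omega |
    (n^-1 * \sum_(1 <= t < T.+1) enorm (grad f (xb t w)) ^+ 2 <=
      (3 * DeltaL * G0 / eta
       + 9 * DeltaL ^+ 2 / (2 * eta ^+ 2) * (B + 1)) * n^-1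
      + 3 * DeltaL / (eta * Num.sqrt n) * Num.sqrt (2 * (A * DeltaL + C)))%R])%E.
Proof.
cbv zeta; set n : R := T%:R.
set F := ln _; set DeltaL := (X in 3 * X * G0).
have /andP[delta_gt0 delta_lt1] := hdelta.
have [mG _] := horacle.
have fs_le := inf_le hinf.
have n_gt0 : 0 < n by rewrite ltr0n.
have l_ge0 : 0 <= ln (n / delta).
  by rewrite ln_ge0// ler_pdivlMr// mul1r (le_trans (ltW delta_lt1))// ler1n.
(* Both algorithms are brought to the common form with multiplier [c]; AdaGrad-Norm has [c] equal to
   1 and zero lag. *)
have [alpha [c [alg lag]]] : exists alpha c : nat -> R,
    (forall w, agd T alpha (adaptive_step eta G0 (g ^~ w))
      (fun t => c t * adaptive_step eta G0 (g ^~ w) t)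
      (fun t y => G y (z t w)) x1 (x ^~ w) (xt ^~ w) (xb ^~ w) (g ^~ w)) /\
    (forall w t, (1 <= t <= T)%N -> enorm (xb t w - x t w) <= eta /\
      \sum_(1 <= k < t.+1) enorm (xb k w - x k w) ^+ 2 <=
      2 * \sum_(1 <= k < t.+1)
        (adaptive_step eta G0 (g ^~ w) k ^+ 2 * enorm (g k w) ^+ 2)).
  case: halg => [[alpha [_ alg]]|alg].
    exists alpha, (fun=> 1); split.
      move=> w; case: (alg w) => *; split => // t tT.
      by rewrite mul1r; auto.
    move=> w t /andP[t1 tT].
    have xbx k : (1 <= k <= T)%N -> xb k w = x k w by exact: adagrad_norm_lag (alg w).
    split; first by rewrite xbx ?t1// subrr enorm0 ltW.
    rewrite big_nat big1 ?mulr_ge0//.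
      by apply: sumr_ge0 => k _; rewrite mulr_ge0// sqr_ge0.
    move=> k /andP[k1 kt]; rewrite xbx ?subrr ?enorm0 ?expr0n//.
    by rewrite k1 (leq_trans _ tT).
  exists (@rsag_alpha R), (fun t => 1 + rsag_alpha R t); split => // w t tT.
  split; first exact: rsag_lag_le (alg w) _ tT.
  have /andP[_ tT'] := tT.
  apply: le_trans (rsag_lag_sum heta hG0 (alg w) tT').
  by rewrite lerDl mulr_ge0 ?sqr_ge0.
pose M := Num.sqrt ((A + 2 * B * L) * DeltaL + C).
have k_ge0 : 0 <= A + 2 * B * L by rewrite addr_ge0 ?mulr_ge0// ltW.
have DeltaL_ge0 : 0 <= DeltaL by exact: DeltaL_ge0.
have M_gt0 : 0 < M by rewrite sqrtr_gt0 ltr_wpDl// mulr_ge0.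
have nzM y : f y - inf (range f) <= DeltaL ->
    Num.sqrt (noise_level f (inf (range f)) A B C y) <= M.
  exact: sqrt_noise_level_le.
have [bad [mbad Pbad good]] := good_event hz mG hL hsmooth hinf hunbiased
  hA hB hC hnoise heta hG0 alg M_gt0 nzM (ln (n / delta)).
(* The level [ln (n / delta)] makes [T%:R * expR (- l)] equal to [delta]. *)
have delta_bad : (P bad <= delta%:E)%E.
  apply: le_trans Pbad _; rewrite lee_fin -lnV ?posrE ?divr_gt0//.
  by rewrite lnK ?posrE ?invr_gt0 ?divr_gt0// invf_div mulrC divfK ?gt_eqF.
apply: (@le_trans _ _ (P (~` bad))).
  by rewrite probability_setC// EFinB leeB.
apply: le_measure; rewrite ?inE.
- exact: measurableC.
- rewrite -[X in measurable X]setTI.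
  apply: (@measurable_fun_ler _ _ _ setT _ _ _ _ measurableT [set true]) => //.
  exact: (sum_grad_measurable mG hL hsmooth hG0 alg).
move=> w /good{}good.
have step t : (1 <= t <= T)%N ->
    x t.+1 w = x t w - adaptive_step eta G0 (g ^~ w) t *: g t w.
  by move=> tT; exact: (agd_x (alg w) tT).
apply: (@sum_grad_sqr_le _ _ L f _ T eta G0 A B C x1 (x ^~ w) (xb ^~ w) (g ^~ w)) => //.
- exact: (agd_x_init (alg w)).
- by move=> t /(lag w)[].
- by move=> t /(lag w)[].
- by move=> t /good[].
- by move=> t tT; apply: (martingale_le heta alg M_gt0 tT); have [] := good t tT.
Qed.
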